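(* Let $Z$ be a random variable with values in a Polish space $\mathcal{Z}$. Let $Y=(Y_1,\dots,Y_N)$ and $X=(X_1,\dots,X_N)$ be stochastic processes (on the same probability space) with values in Polish spaces $\mathcal{Y}$ and $\mathcal{X}$ respectively, where $\mathcal{X}$ is homeomorphic to a convex subset of a locally convex space. Suppose the law of $Y_1$ is nonatomic and $Y_n$ is $\sigma(Z)$-measurable for every $n$. Let $\mathcal{F}^X_n=\sigma(X_1,\dots,X_n)$ and $\mathcal{F}^Y_n=\sigma(Y_1,\dots,Y_n)$. Then the following are equivalent: (i) For each $n=1,\dots,N$, $\mathcal{F}^X_n$ is conditionally independent of $Z$ given $\mathcal{F}^Y_n$. (ii) There exists a sequence $X^{(k)}=(X^{(k)}_1,\dots,X^{(k)}_N)$ of $(\mathcal{F}^Y_n)_{n=1}^N$-adapted processes such that $(Z,X^{(k)})\to(Z,X)$ in law in $\mathcal{Z}\times\mathcal{X}^N$. (iii) There exists a sequence $X^{(k)}$ as in (ii) with, in addition, $X^{(k)}_n=f^k_n(Y_1,\dots,Y_n)$ for some continuous functions $f^k_n:\mathcal{Y}^n\to\mathcal{X}$.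
   Context: A process $(X'_n)$ is $(\mathcal{F}^Y_n)$-adapted if $X'_n$ is $\mathcal{F}^Y_n$-measurable for each $n$. *)

(* Defs.v *)
From HB Require Import structures.
From mathcomp Require Import all_boot all_order all_algebra.
From mathcomp Require Import all_classical all_reals all_analysis.
Set Implicit Arguments. Unset Strict Implicit. Unset Printing Implicit Defensive.
Import Order.TTheory GRing.Theory Num.Theory.
Import numFieldNormedType.Exports.
Local Open Scope classical_set_scope.
Local Open Scope ring_scope.

Definition polish (R : realType) (T : topologicalType) : Prop :=
  (exists S : set T, countable S /\ closure S = setT) /\
  exists d : T -> T -> R,
    (forall x y, 0 <= d x y) /\
    [/\ (forall x y, d x y = 0 <-> x = y),
        (forall x y, d x y = d y x),
        (forall x y z, d x z <= d x y + d y z),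
        (forall A : set T, open A <->
           (forall x, A x -> exists2 e : R, 0 < e & [set y | d x y < e] `<=` A)) &
        (forall u : nat -> T,
           (forall e : R, 0 < e -> exists M : nat, forall m n,
              (M <= m)%N -> (M <= n)%N -> d (u m) (u n) < e) ->
           exists l : T, forall e : R, 0 < e -> exists M : nat, forall n,
              (M <= n)%N -> d (u n) l < e)].

Definition homeo_convex_lcs (R : realType) (T : topologicalType) : Prop :=
  exists (E : tvsType R) (C : set E) (h : T -> E) (g : E -> T),
    [/\ convex_set C, h @` setT = C, continuous h,
        {within C, continuous g} & (forall x, g (h x) = x)].

Definition borel (T : topologicalType) : set (set T) := <<s open >>.

Definition random_var d (Omega : measurableType d) (T : topologicalType)
  (f : Omega -> T) : Prop :=
  forall A : set T, open A -> measurable (f @^-1` A).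

Definition sigma_gen (Omega : Type) (I : Type) (T : topologicalType)
  (X : I -> Omega -> T) (J : set I) : set (set Omega) :=
  <<s [set B | exists i, J i /\ exists A : set T, open A /\ B = X i @^-1` A] >>.

Definition sigma_rv (Omega : Type) (T : topologicalType) (Z : Omega -> T) :=
  sigma_gen (fun _ : unit => Z) setT.

Definition meas_wrt (Omega : Type) (T : topologicalType)
  (F : set (set Omega)) (f : Omega -> T) : Prop :=
  forall A : set T, open A -> F (f @^-1` A).

Definition nonatomic_law d (Omega : measurableType d) (R : realType)
  (P : probability Omega R) (T : topologicalType) (Y : Omega -> T) : Prop :=
  forall A, borel A -> (0 < P (Y @^-1` A))%E ->
    exists B, [/\ borel B, B `<=` A, (0 < P (Y @^-1` B))%E &
                   (P (Y @^-1` B) < P (Y @^-1` A))%E].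

Definition cond_prob_version d (Omega : measurableType d) (R : realType)
  (P : probability Omega R) (F : set (set Omega)) (A : set Omega)
  (g : Omega -> R) : Prop :=
  [/\ (forall B : set R, measurable B -> F (g @^-1` B)),
      P.-integrable setT (EFin \o g) &
      (forall C, F C -> (\int[P]_(x in C) (g x)%:E = P (A `&` C))%E)].

Definition cond_indep d (Omega : measurableType d) (R : realType)
  (P : probability Omega R) (G H F : set (set Omega)) : Prop :=
  forall A B, G A -> H B ->
  forall gA gB gAB : Omega -> R,
    cond_prob_version P F A gA -> cond_prob_version P F B gB ->
    cond_prob_version P F (A `&` B) gAB ->
    {ae P, forall x, gAB x = gA x * gB x}.

Definition conv_law d (Omega : measurableType d) (R : realType)
  (P : probability Omega R) (Zs Xs : topologicalType) (N : nat)
  (Z : Omega -> Zs) (Xk : nat -> 'I_N -> Omega -> Xs) (X : 'I_N -> Omega -> Xs)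
  : Prop :=
  forall f : Zs * {ptws 'I_N -> Xs} -> R, continuous f ->
    (exists M : R, forall p, `|f p| <= M) ->
    (fun k => (\int[P]_x (f (Z x, fun i => Xk k i x))%:E)%E) @ \oo -->
      (\int[P]_x (f (Z x, fun i => X i x))%:E)%E.

(* Main.v *)
Require Import Defs.
From HB Require Import structures.
From mathcomp Require Import all_boot all_order all_algebra.
From mathcomp Require Import all_classical all_reals all_analysis.
From mathcomp Require Import measurable_realfun.
From mathcomp Require Import ring lra.
Set Implicit Arguments. Unset Strict Implicit. Unset Printing Implicit Defensive.
Import Order.TTheory GRing.Theory Num.Theory.
Import numFieldNormedType.Exports.
Local Open Scope classical_set_scope.
Local Open Scope ring_scope.

(** Condition (i) says that the conditional law of (X_1, ..., X_n) given Z is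
    F^Y_n-measurable.  If (ii) holds, then E[phi(X^k) 1_B] = E[phi(X^k) P(B | F^Y_n)]
    for every B in sigma(Z), since X^k is adapted; this passes to the limit in k because
    1_B and P(B | F^Y_n), as functions of Z, are approximated by continuous ones.
    Conversely, convergence in law of (Z, X^k) only has to be tested on finite unions of
    open boxes, so X may be encoded by finitely many bits, revealed one at a time along
    the filtration.  Each bit is simulated from Y: given the bits already simulated, its
    conditional probability q is F^Y_n-measurable by (i), and the simulated bit is the
    event {V < M q} (up to rounding) for a {0, ..., M-1}-valued function V of Y_1 that is
    nearly uniform and nearly independent of any prescribed finite family of events; V
    exists because the law of Y_1 is nonatomic.  Finally, off a set of small
    probability, the indicator of an event of sigma(Y_1, ..., Y_n) is a continuous
    function of (Y_1, ..., Y_n), and convex combinations in X turn finitely many such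
    functions into a continuous map which there equals the simulated process. *)

(** * Real-valued probabilities *)

(** No regular conditional law and no auxiliary uniform variable is used: only conditional
    probabilities of finitely many events occur, and each new bit gets its own [V], cut out of Y_1
    once the earlier bits are fixed, so that near independence of those bits can be demanded. Hence
    the induction over bits carries an arbitrary finite family of test events in sigma(Z): each step
    enlarges it by level events of q. One-sided bounds are enough. If P((Z, X) in G) is at most
    P((Z, X^k) in G) plus a vanishing error for every open G, the superlevel sets of f and of -f
    give convergence of expectations. So a simulated value only has to lie in the boxes whose bits
    are on; it may fall into others too. Exactness matters: continuous functions must equal 0 or 1
    off a small event, because a convex combination with fractional weights can leave every box.
    Also, [cond_indep] quantifies over given versions of conditional probabilities, so it yields
    nothing until Radon-Nikodym supplies them. In the converse direction errors are uniform in k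
    because Z does not depend on k. *)

Lemma bigsetUP (T : Type) (I : finType) (Q : pred I) (F : I -> set T) (w : T) :
  (\big[setU/set0]_(i | Q i) F i) w <-> exists i, Q i /\ F i w.
Proof.
split=> [|[i [Qi Fi]]]; last by rewrite (bigD1 i)//=; left.
by elim/big_ind: _ => // [A B IA IB [/IA|/IB]//|i Qi Fi]; exists i.
Qed.

Section RealProbability.
Context (d : measure_display) (Omega : measurableType d) (R : realType).
Variable P : probability Omega R.
Implicit Types A B C : set Omega.

Definition pr (A : set Omega) : R := fine (P A).

Lemma prE A : measurable A -> P A = (pr A)%:E.
Proof. by move=> mA; rewrite /pr fineK// fin_num_measure. Qed.

Lemma pr_ge0 A : 0 <= pr A.
Proof. by rewrite /pr fine_ge0. Qed.

Lemma pr_le1 A : measurable A -> pr A <= 1.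
Proof. by move=> mA; rewrite -lee_fin -prE// probability_le1. Qed.

Lemma pr0 : pr set0 = 0.
Proof. by rewrite /pr measure0. Qed.

Lemma prT : pr setT = 1.
Proof. by rewrite /pr probability_setT. Qed.

Lemma le_pr A B : measurable A -> measurable B -> A `<=` B -> pr A <= pr B.
Proof.
by move=> mA mB AB; rewrite -lee_fin -!prE// le_measure// inE.
Qed.

Lemma prU A B : measurable A -> measurable B -> A `&` B = set0 ->
  pr (A `|` B) = pr A + pr B.
Proof.
move=> mA mB AB; apply: EFin_inj; rewrite EFinD -!prE//; last exact: measurableU.
by rewrite measureU.
Qed.

Lemma pr_split A B : measurable A -> measurable B ->
  pr A = pr (A `&` B) + pr (A `&` ~` B).
Proof.
move=> mA mB; rewrite -prU; first by rewrite -setIUr setUv setIT.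
- exact: measurableI.
- by apply: measurableI => //; exact: measurableC.
- by rewrite setIACA setICr setI0.
Qed.

Lemma pr_leU A B : measurable A -> measurable B -> pr (A `|` B) <= pr A + pr B.
Proof.
move=> mA mB; rewrite -lee_fin EFinD -!prE//; last exact: measurableU.
exact: measureU2.
Qed.

Lemma pr_bigU (I : finType) (Q : pred I) (F : I -> set Omega) :
  (forall i, measurable (F i)) ->
  (forall i j w, F i w -> F j w -> i = j) ->
  pr (\big[setU/set0]_(i | Q i) F i) = \sum_(i | Q i) pr (F i).
Proof.
move=> mF tF.
have [] : measurable (\big[setU/set0]_(i | Q i) F i) /\
   pr (\big[setU/set0]_(i | Q i) F i) = \sum_(i | Q i) pr (F i); last by [].
rewrite -!(big_filter _ Q); have : uniq [seq i <- index_enum I | Q i].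
  exact: filter_uniq (index_enum_uniq I).
elim: [seq i <- index_enum I | Q i] => [|i s IH] /=.
  by rewrite !big_nil pr0; split.
move=> /andP[ins us]; rewrite !big_cons.
have [mB IB] := IH us; split; first exact: measurableU.
rewrite prU//; first by rewrite IB.
rewrite predeqE => w; split => // -[Fi]; rewrite -bigcup_seq => -[j /= js Fj].
by move: ins; rewrite (tF _ _ _ Fi Fj) js.
Qed.

Lemma pr_le_bigU (I : Type) (r : seq I) (Q : pred I) (F : I -> set Omega) :
  (forall i, measurable (F i)) ->
  pr (\big[setU/set0]_(i <- r | Q i) F i) <= \sum_(i <- r | Q i) pr (F i).
Proof.
move=> mF; elim: r => [|i r IH]; first by rewrite !big_nil pr0.
rewrite !big_cons; case: ifP => // _.
have mB : measurable (\big[setU/set0]_(j <- r | Q j) F j).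
  exact: bigsetU_measurable.
by apply: (le_trans (pr_leU _ _)) => //; rewrite lerD2l.
Qed.

Lemma pr_small_tail (F : nat -> set Omega) (e : R) :
  (forall i, measurable (F i)) -> (forall m n, (m <= n)%N -> F n `<=` F m) ->
  (forall w, exists n, ~ F n w) -> 0 < e -> exists n, pr (F n) < e.
Proof.
move=> mF dF F0 e0.
have cap0 : \bigcap_n F n = set0.
  by rewrite predeqE => w; split => // Fw; have [n] := F0 w; apply; exact: Fw.
have : (P \o F) x @[x --> \oo] --> P (\bigcap_n F n).
  apply: nonincreasing_cvg_mu => //.
  - by rewrite -ge0_fin_numE ?fin_num_measure.
  - by rewrite cap0.
  - by move=> m n mn; apply/subsetPset; exact: dF.
rewrite cap0 measure0 => /fine_cvg /= /cvgrPdist_lt /(_ _ e0) [n _ /(_ n)].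
move=> /(_ (leqnn n)) /=; rewrite sub0r normrN => /(le_lt_trans (ler_norm _)).
by exists n.
Qed.

(** Continuity from above as an epsilon statement. It turns countable unions into finite ones: of
    Lusin events, of small cells, of boxes inside an open set. *)
Lemma pr_bigcup_tail (F : nat -> set Omega) (e : R) :
  (forall i, measurable (F i)) -> 0 < e ->
  exists n, pr ((\bigcup_i F i) `\` \big[setU/set0]_(i < n) F i) < e.
Proof.
move=> mF e0.
have [| |w|n Hn] := @pr_small_tail
   (fun n => (\bigcup_i F i) `\` \big[setU/set0]_(i < n) F i) e _ _ _ e0.
- move=> i; apply: measurableD; first exact: bigcupT_measurable.
  exact: bigsetU_measurable.
- move=> m n mn w [Fw nFw]; split => //; apply: contra_not nFw.
  by apply: subset_bigsetU.
- have [[i _ Fi]|nF] := pselect ((\bigcup_i F i) w).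
    exists i.+1 => -[_]; apply; rewrite -bigcup_mkord; exists i => //=.
  by exists 0%N => -[].
- by exists n.
Qed.

End RealProbability.

(** * Polish spaces and products *)

Section Polish.
Context (R : realType) (T : topologicalType).

Lemma polish_open_setC1 : polish R T -> forall y : T, open (~` [set y]).
Proof.
move=> [_ [dd [dd0 [dd1 dsym dtri dop dc]]]] y; apply/dop => x xy.
exists (dd x y) => [|z xz zy].
  by rewrite lt_neqAle dd0 andbT eq_sym; apply/eqP => /dd1.
by move: xz; rewrite zy /= ltxx.
Qed.

(** A countable base of cozero sets: [v i] is a radius [1 / m.+1] minus the distance to a point of
    the countable dense set. Functions are kept instead of balls because the Lusin approximation
    starts from them. *)
Lemma polish_base : polish R T ->
  exists v : nat -> T -> R, (forall i, continuous (v i)) /\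
    forall (G : set T) x, open G -> G x ->
      exists i, 0 < v i x /\ forall y, 0 < v i y -> G y.
Proof.
move=> [[S [cS dS]] [dd [dd0 [dd1 dsym dtri dop dc]]]].
have dballn x e : 0 < e -> nbhs x [set y | dd x y < e].
  move=> e0; apply: open_nbhs_nbhs; split; last first.
    by rewrite /= (dd1 x x).2.
  apply/dop => y /= xy; exists (e - dd x y); first by rewrite subr_gt0.
  by move=> z /=; rewrite ltrBrDl; exact: le_lt_trans (dtri _ _ _).
(* The empty space is set apart, since its dense set cannot be enumerated by [nat]. *)
have [x0|nT] := pselect (exists x : T, True); last first.
  exists (fun _ _ => 0); split; first by move=> i x; case: nT; exists x.
  by move=> G x; case: nT; exists x.
have [S0|] := pfcard_geP cS.
  case: x0 => x _; have : closure S x by rewrite dS.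
  by rewrite S0 closure0.
move=> [c].
exists (fun i x => (if unpickle i is Some p then (p.2.+1%:R : R)^-1 - dd (c p.1) x else 0)).
split.
  move=> i; case: (unpickle i) => [[j m]|]; last exact: cst_continuous.
  move=> x /=; apply: cvgB; first exact: cvg_cst.
  apply/cvgrPdist_lt => e e0; near=> y.
  have xy : dd x y < e by near: y; exact: dballn.
  rewrite ltr_norml; apply/andP; split.
    by rewrite ltrNl opprB ltrBlDl (le_lt_trans (dtri _ x _))// ltrD2l.
  by rewrite ltrBlDl (le_lt_trans (dtri _ y _))// ltrD2l dsym.
move=> G x /dop oG /oG [e e0 eG].
(* A ball of radius below [e / 2] that contains [x] stays within distance [e] of [x]. *)
have [m me] : exists m : nat, (m.+1%:R : R)^-1 < e / 2.
  exists (Num.truncn (e / 2)^-1); rewrite invf_plt ?posrE ?divr_gt0//.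
  by rewrite truncnS_gt.
have : closure S x by rewrite dS.
move=> /(_ [set y | dd x y < (m.+1%:R : R)^-1]) []; first exact: dballn.
move=> s [Ss xs].
have [j _ js] := @surj _ _ _ _ c s Ss.
exists (pickle (j, m)); rewrite pickleK/= js; split; first by rewrite subr_gt0 dsym.
move=> y; rewrite subr_gt0 => sy; apply: eG => /=.
rewrite (le_lt_trans (dtri _ s _))// (splitr e) ltrD//.
  exact: lt_trans me.
exact: lt_trans me.
Unshelve. all: by end_near.
Qed.

End Polish.

Lemma ptws_proj_continuous (I : choiceType) (T : topologicalType) (i : I) :
  continuous (fun x : {ptws I -> T} => x i).
Proof. exact: (@proj_continuous I (fun _ => T) i). Qed.

Lemma continuous_to_ptws (I : choiceType) (S T : topologicalType)
    (f : S -> {ptws I -> T}) :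
  (forall i, continuous (fun s => f s i)) -> continuous f.
Proof.
move=> cf s; apply/cvg_sup => i.
move=> A; rewrite nbhs_simpl /= => -[V [[U oU <-] Ux] UA].
apply: (@filterS _ _ _ ((fun s => f s i) @^-1` U)) => [t Ut|]; first exact: UA.
exact: cf (open_nbhs_nbhs (conj oU Ux)).
Qed.

(** The sets containing an open box around [x] form a filter [F]. Its convergence to [x] in the
    supremum topology can be checked one coordinate at a time, and convergence means that [F]
    contains every neighbourhood. *)
Lemma ptws_nbhs_box (I : finType) (T : topologicalType) (x : {ptws I -> T})
    (G : set {ptws I -> T}) : nbhs x G ->
  exists B : I -> set T, [/\ forall i, open (B i), forall i, B i (x i) &
    forall y : {ptws I -> T}, (forall i, B i (y i)) -> G y].
Proof.
have nb (i : I) (B : set T) : nbhs (x i) B -> exists C : I -> set T,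
    [/\ forall i, open (C i), forall i, C i (x i) &
      forall y : I -> T, (forall i, C i (y i)) -> B (y i)].
  rewrite nbhsE => -[U [oU Ux] UB].
  exists (fun j => if j == i then U else setT); split.
  - by move=> j; case: eqP => _ //; exact: openT.
  - by move=> j; case: eqP => [->|].
  - by move=> y /(_ i); rewrite eqxx => /UB.
pose F : set_system {ptws I -> T} := fun G => exists B : I -> set T,
  [/\ forall i, open (B i), forall i, B i (x i) &
    forall y : {ptws I -> T}, (forall i, B i (y i)) -> G y].
have FF : Filter F.
  split.
  - by exists (fun=> setT); split => // i; exact: openT.
  - move=> A B [C [oC Cx CA]] [D [oD Dx DB]]; exists (fun i => C i `&` D i).
    split; first by move=> i; exact: openI.
    + by [].
    + by move=> y yCD; split; [apply: CA|apply: DB] => i; case: (yCD i).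
  - by move=> A B AB [C [oC Cx CA]]; exists C; split => // y /CA /AB.
have : F --> (x : {ptws I -> T}).
  apply/cvg_sup => i A; rewrite nbhs_simpl /= => -[V [[U oU <-] Ux] UA].
  have [C [oC Cx CB]] := nb i U (open_nbhs_nbhs (conj oU Ux)).
  by exists C; split => // y /CB /UA.
by move=> /(_ G); apply.
Qed.

(** * Sigma-algebras as families of sets *)

Section SigmaGen.
Context (Omega I : Type) (T : topologicalType) (X : I -> Omega -> T).

Lemma sigma_gen_alg (J : set I) : sigma_algebra setT (sigma_gen X J).
Proof. exact: smallest_sigma_algebra. Qed.

Lemma sigma_gen_open (J : set I) i (A : set T) : J i -> open A ->
  sigma_gen X J (X i @^-1` A).
Proof. by move=> Ji oA; apply: sub_sigma_algebra; exists i; split => //; exists A. Qed.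

Lemma sigma_gen_min (J : set I) (F : set (set Omega)) : sigma_algebra setT F ->
  (forall i, J i -> meas_wrt F (X i)) -> sigma_gen X J `<=` F.
Proof.
move=> sF XF; apply: smallest_sub => // B [i [Ji [A [oA ->]]]]; exact: XF.
Qed.

End SigmaGen.

Section SigmaAlgebra.
Context (Omega : Type) (F : set (set Omega)).
Hypothesis sF : sigma_algebra setT F.

Lemma salg0 : F set0. Proof. by case: sF. Qed.

Lemma salgC A : F A -> F (~` A).
Proof. by move=> FA; rewrite -setTD; case: sF => _ + _; apply. Qed.

Lemma salgT : F setT. Proof. by rewrite -setC0; exact/salgC/salg0. Qed.

Lemma salg_bigcupT (A : nat -> set Omega) :
  (forall i, F (A i)) -> F (\bigcup_i A i).
Proof. by case: sF => _ _; apply. Qed.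

Lemma salgU A B : F A -> F B -> F (A `|` B).
Proof.
move=> FA FB; rewrite -bigcup2E; apply: salg_bigcupT => -[|[|i]] //; exact: salg0.
Qed.

Lemma salgI A B : F A -> F B -> F (A `&` B).
Proof. by move=> FA FB; rewrite -[A `&` B]setCK setCI; apply/salgC/salgU; exact: salgC. Qed.

Lemma salgD A B : F A -> F B -> F (A `\` B).
Proof. by move=> FA FB; rewrite setDE; apply: salgI => //; exact: salgC. Qed.

Lemma salg_bigcup (J : countType) (Q : set J) (A : J -> set Omega) :
  (forall i, Q i -> F (A i)) -> F (\bigcup_(i in Q) A i).
Proof.
move=> FA; pose B n := if unpickle n is Some i then
  (if `[< Q i >] then A i else set0) else set0.
rewrite (_ : \bigcup_(i in Q) A i = \bigcup_n B n).
  apply: salg_bigcupT => n; rewrite /B; case: (unpickle n) => [i|]; last exact: salg0.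
  by case: asboolP => [/FA//|_]; exact: salg0.
rewrite predeqE => w; split => [[i Qi Aw]|[n _]].
  by exists (pickle i) => //; rewrite /B pickleK asboolT.
rewrite /B; case: (unpickle n) => [i|[]].
by case: asboolP => [Qi Aw|_ []]; exists i.
Qed.

Lemma salg_bigcap (J : countType) (A : J -> set Omega) :
  (forall i, F (A i)) -> F [set w | forall i, A i w].
Proof.
move=> FA; rewrite (_ : mkset _ = ~` \bigcup_(i in setT) ~` A i).
  by apply: salgC; apply: salg_bigcup => i _; exact: salgC.
rewrite predeqE => w; split=> [Aw [i _]|nA i]; first exact.
by apply: contrapT => nAi; apply: nA; exists i.
Qed.

Lemma salg_bigU (J : Type) (r : seq J) (Q : pred J) (A : J -> set Omega) :
  (forall i, Q i -> F (A i)) -> F (\big[setU/set0]_(i <- r | Q i) A i).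
Proof. by move=> FA; apply: big_ind => //; [exact: salg0|exact: salgU]. Qed.

End SigmaAlgebra.

Lemma sigma_gen_measurable d (Omega : measurableType d) (I : Type)
  (T : topologicalType) (X : I -> Omega -> T) (J : set I) :
  (forall i, random_var (X i)) -> sigma_gen X J `<=` measurable.
Proof.
move=> mX; apply: sigma_gen_min => [|i _]; last exact: mX.
exact: sigma_algebra_measurable.
Qed.

Lemma continuous_open_pos (R : realType) (T : topologicalType) (v : T -> R) :
  continuous v -> open [set y | 0 < v y].
Proof.
by move=> cv; apply: (@open_comp _ _ v [set t | 0 < t]) => [x _|];
  [exact: cv|exact: open_gt].
Qed.

Section ContinuousReal.
Context (S : topologicalType) (R : realType).
Implicit Types u v : S -> R.

Lemma continuous_1B u : continuous u -> continuous (fun x => 1 - u x).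
Proof. by move=> cu x; apply: cvgB; [exact: cvg_cst|exact: cu]. Qed.

Lemma continuous_join u v : continuous u -> continuous v ->
  continuous (fun x => 1 - (1 - u x) * (1 - v x)).
Proof.
move=> cu cv; apply: continuous_1B => x.
by apply: cvgM; [exact: continuous_1B|exact: continuous_1B].
Qed.

Lemma continuous_clamp (n : nat) v : continuous v ->
  continuous (fun x => Num.min 1 (Num.max 0 (n.+1%:R * v x)) : R).
Proof.
move=> cv x; apply: (@continuous_min R S (fun=> 1)
    (fun y => Num.max 0 (n.+1%:R * v y)) x); first exact: cvg_cst.
apply: (@continuous_max R S (fun=> 0) (fun y => n.+1%:R * v y) x).
  exact: cvg_cst.
by apply: cvgM; [exact: cvg_cst|exact: cv].
Qed.

End ContinuousReal.

(** * Indicators that are continuous functions of the process off a small event *)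

Section Lusin.
Context (d : measure_display) (Omega : measurableType d) (R : realType).
Variable P : probability Omega R.
Context (I : finType) (T : topologicalType) (X : I -> Omega -> T).
Hypothesis pT : polish R T.
Hypothesis mX : forall i, random_var (X i).

(* [u] is required to be exactly the indicator off [E], not merely close to it: this
   is stable under countable unions, and [decision_tree] needs exact bits. *)
Definition lusin (A : set Omega) := measurable A /\ forall e : R, 0 < e ->
  exists u : {ptws I -> T} -> R, [/\ continuous u, forall x, 0 <= u x <= 1 &
  exists E, [/\ measurable E, pr P E < e &
     forall w, ~ E w -> u (fun i => X i w) = \1_A w]].

Lemma lusin0 : lusin set0.
Proof.
split => // e e0; exists (fun _ => 0); split; first exact: cst_continuous.
  by move=> x; rewrite lexx ler01.
by exists set0; split => //; [rewrite pr0|move=> w _; rewrite indic0].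
Qed.

Lemma lusinC A : lusin A -> lusin (~` A).
Proof.
move=> [mA lA]; split; first exact: measurableC.
move=> e /lA[u [cu u01 [E [mE Ee uE]]]]; exists (fun x => 1 - u x); split.
- exact: continuous_1B.
- by move=> x; have := u01 x; lra.
- by exists E; split => // w /uE ->; rewrite !indicE in_setC; case: (w \in A) => /=; ring.
Qed.

Lemma lusinU A B : lusin A -> lusin B -> lusin (A `|` B).
Proof.
move=> [mA lA] [mB lB]; split; first exact: measurableU.
move=> e e0; have e20 : 0 < e / 2 by rewrite divr_gt0.
have [u [cu u01 [E [mE Ee uE]]]] := lA _ e20.
have [v [cv v01 [G [mG Ge vG]]]] := lB _ e20.
(* On bits this is the disjunction, and it stays within [[0, 1]]. *)
exists (fun x => 1 - (1 - u x) * (1 - v x)); split.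
- exact: continuous_join.
- by move=> x; have := u01 x; have := v01 x; nra.
- exists (E `|` G); split; first exact: measurableU.
    by rewrite (le_lt_trans (pr_leU P mE mG))// (splitr e) ltrD.
  move=> w /not_orP[/uE -> /vG ->]; rewrite !indicE in_setU.
  by case: (w \in A); case: (w \in B) => /=; ring.
Qed.

(** A finite part of the union is Lusin; the rest, where its indicator is wrong, has small
    probability and joins the exceptional event. *)
Lemma lusin_bigcup (A : nat -> set Omega) : (forall n, lusin (A n)) ->
  lusin (\bigcup_n A n).
Proof.
move=> lA; have mA n : measurable (A n) by case: (lA n).
split; first exact: bigcupT_measurable.
move=> e e0; have e20 : 0 < e / 2 by rewrite divr_gt0.
have [n Hn] := pr_bigcup_tail P mA e20.
have : lusin (\big[setU/set0]_(i < n) A i).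
  by apply: big_ind => //; [exact: lusin0|exact: lusinU].
move=> [mU] /(_ _ e20)[u [cu u01 [E [mE Ee uE]]]].
exists u; split => //.
set D := _ `\` _ in Hn.
have mD : measurable D by apply: measurableD => //; exact: bigcupT_measurable.
exists (E `|` D); split; first exact: measurableU.
  by rewrite (le_lt_trans (pr_leU P mE mD))// (splitr e) ltrD.
move=> w /not_orP[/uE -> Dw]; rewrite !indicE; congr ((nat_of_bool _)%:R).
apply/idP/idP; rewrite !inE; last by move=> Aw; apply: contrapT => nAw; exact: Dw.
by rewrite -bigcup_mkord => -[k _ Ak]; exists k.
Qed.

(** Clamping [n.+1 * v] to [[0, 1]] gives the indicator of [0 < v] except where [0 < v < 1 / n.+1],
    and these events decrease to the empty set. *)
Lemma lusin_pos i (v : T -> R) : continuous v -> lusin (X i @^-1` [set y | 0 < v y]).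
Proof.
move=> cv.
have oA (a : R) : open [set y | a < v y].
  by apply: (@open_comp _ _ v [set t | a < t]) => [x _|]; [exact: cv|exact: open_gt].
have oA' (a : R) : open [set y | v y < a].
  by apply: (@open_comp _ _ v [set t | t < a]) => [x _|]; [exact: cv|exact: open_lt].
split; first exact/mX/oA.
move=> e e0; pose E n := X i @^-1` ([set y | 0 < v y] `&` [set y | v y < n.+1%:R^-1]).
have mE n : measurable (E n) by apply: mX; exact: openI.
have [|w|n Hn] := @pr_small_tail _ _ _ P E e mE _ _ e0.
- move=> m n mn w [/= v0 vn]; split => //=; apply: (lt_le_trans vn).
  by rewrite lef_pV2 ?posrE// ler_nat.
- have [v0|v0] := pselect (0 < v (X i w)); last by exists 0%N => -[].
  exists (Num.trunc (v (X i w))^-1) => -[_ /=].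
  by rewrite ltNge invf_ple ?posrE// ltW// truncnS_gt.
pose g (t : R) : R := Num.min 1 (Num.max 0 (n.+1%:R * t)).
exists (fun x => g (v (x i))); split.
- have cvi : continuous (fun x : {ptws I -> T} => v (x i)).
    by move=> x; exact: continuous_comp (@ptws_proj_continuous I T i x) (cv _).
  exact: continuous_clamp cvi.
- by move=> x; rewrite /g le_min ler01 le_max lexx ge_min lexx.
- exists (E n); split => // w nE; rewrite indicE /g.
  have [v0|v0] := ltP 0 (v (X i w)).
    rewrite mem_set//= min_l// le_max -ler_pdivrMl// mulr1.
    rewrite (leNgt _ (v _)); apply/orP; right; apply/negP => vn; exact: nE.
  rewrite memNset /= -?leNgt// ?max_l ?min_r// ?mulr_ge0_le0//.
  by move=> /=; apply/negP; rewrite -leNgt.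
Qed.

(** Lusin events form a sigma-algebra, and every open set is a countable union of cozero sets from
    [polish_base], so the generators are Lusin by [lusin_pos]. *)
Lemma lusin_sigma_gen A : sigma_gen X setT A -> lusin A.
Proof.
apply: smallest_sub.
  split; first exact: lusin0.
    by move=> B lB; rewrite setTD; exact: lusinC.
  exact: lusin_bigcup.
move=> _ [i [_ [B [oB ->]]]].
have [v [cv vB]] := polish_base pT.
rewrite (_ : X i @^-1` B = \bigcup_n
  if `[< (fun y => 0 < v n y) `<=` B >] then X i @^-1` [set y | 0 < v n y] else set0).
  apply: lusin_bigcup => n; case: ifP => _; [exact: lusin_pos|exact: lusin0].
rewrite predeqE => w; split => [Bw|[n _]].
  have [n [vn vBn]] := vB _ _ oB Bw.
  by exists n => //; rewrite asboolT.
by case: asboolP => [vBn /vBn //|_ []].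
Qed.

End Lusin.

(** * Convex combinations *)

(** [cc t x y] is the segment from [h x] to [h y] in the convex set, pulled back by [g]. The two
    endpoints and continuity are all that [decision_tree] asks for. *)
Lemma convex_combination (R : realType) (T : topologicalType) :
  homeo_convex_lcs R T ->
  exists cc : R -> T -> T -> T, [/\ forall x y, cc 0 x y = x,
    forall x y, cc 1 x y = y &
    forall (S : topologicalType) (u : S -> R) (f g : S -> T), continuous u ->
      (forall s, 0 <= u s <= 1) -> continuous f -> continuous g ->
      continuous (fun s => cc (u s) (f s) (g s))].
Proof.
move=> [E [C [h [g [cC hC ch cg gh]]]]].
have Ch x : C (h x) by rewrite -hC; exists x.
exists (fun t x y => g ((1 - t) *: h x + t *: h y)); split.
- by move=> x y; rewrite subr0 scale1r scale0r addr0 gh.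
- by move=> x y; rewrite subrr scale1r scale0r add0r gh.
move=> S u f1 f2 cu u01 c1 c2.
pose w s := (1 - u s) *: h (f1 s) + u s *: h (f2 s).
have Cw s : C (w s).
  have [u0 u1] := andP (u01 s).
  have v01 : 0 <= (1 - u s) <= 1 by rewrite subr_ge0 u1 gerBl u0.
  have := cC (h (f1 s)) (h (f2 s)) (Itv01 (andP v01).1 (andP v01).2).
  rewrite !inE => /(_ (Ch _) (Ch _)).
  have e : 1 - (1 - u s) = u s := subKr _ _.
  suff -> : w s = (1 - u s) *: h (f1 s) + (1 - (1 - u s)) *: h (f2 s) by [].
  by rewrite e.
have cscale (a : S -> R) (k : S -> E) : continuous a -> continuous k ->
    continuous (fun s => a s *: k s).
  move=> ca ck s.
  apply: (@continuous_comp S (R^o * E)%type E (fun s => (a s, k s))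
    (fun z : R^o * E => z.1 *: z.2)).
    exact: cvg_pair (ca s) (ck s).
  exact: scale_continuous.
have cw : continuous w.
  move=> s; apply: (@continuous_comp S (E * E)%type E
    (fun s => ((1 - u s) *: h (f1 s), u s *: h (f2 s))) (fun z => z.1 + z.2)).
    apply: cvg_pair (cscale _ _ _ _ s) (cscale _ _ _ _ s) => // [|t|t].
    - exact: continuous_1B.
    - exact: continuous_comp (c1 t) (ch _).
    - exact: continuous_comp (c2 t) (ch _).
  exact: add_continuous.
(* [g] is continuous only within [C]; this suffices because every [w t] lies in [C]. *)
move=> s; have /subspace_continuousP := cg => /(_ (w s) (Cw s)) gw A nA.
have nw : nbhs (w s) [set x | C x -> A (g x)] := gw A nA.
have nCA : nbhs s [set t | C (w t) -> A (g (w t))] := cw s _ nw.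
suff : nbhs s [set t | A (g (w t))] by [].
by apply: filterS nCA => t; apply; exact: Cw.
Qed.

Section Tree.
Context (R : realType) (T S : topologicalType) (cc : R -> T -> T -> T).
Hypothesis cc0 : forall x y, cc 0 x y = x.
Hypothesis cc1 : forall x y, cc 1 x y = y.
Hypothesis cc_continuous : forall (S : topologicalType) (u : S -> R) (f g : S -> T),
  continuous u -> (forall s, 0 <= u s <= 1) -> continuous f -> continuous g ->
  continuous (fun s => cc (u s) (f s) (g s)).

(** The last bit selects one of two smaller trees through [cc (u n s)]. Where [u n s] is exactly 0
    or 1 the combination collapses to one branch; elsewhere it only has to be continuous. *)
Lemma decision_tree (n : nat) (u : nat -> S -> R) (x : seq bool -> T) :
  (forall i, continuous (u i)) -> (forall i s, 0 <= u i s <= 1) ->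
  exists f : S -> T, continuous f /\ forall s (b : nat -> bool),
    (forall i, (i < n)%N -> u i s = (b i)%:R) -> f s = x (mkseq b n).
Proof.
move=> cu u01; elim: n x => [|n IH] x.
  by exists (fun=> x [::]); split => // s; exact: cvg_cst.
have [f0 [cf0 f0E]] := IH (fun c => x (rcons c false)).
have [f1 [cf1 f1E]] := IH (fun c => x (rcons c true)).
exists (fun s => cc (u n s) (f0 s) (f1 s)); split; first exact: cc_continuous.
move=> s b ub; rewrite ub// mkseqS.
have ub' i : (i < n)%N -> u i s = (b i)%:R by move=> iltn; apply: ub; exact: ltnW.
by case: (b n); [rewrite cc1; exact: f1E|rewrite cc0; exact: f0E].
Qed.

End Tree.

(** * Nearly independent partitions from a nonatomic law *)

(* The labels are chosen greedily: summed over all labels, the cross terms with the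
   current errors cancel, so some label adds at most the new square terms. *)
Lemma balanced_labels (R : realFieldType) (J : finType) (m n : nat)
    (c : J -> nat -> R) :
  exists lab : nat -> 'I_m.+1,
    \sum_e \sum_j (\sum_(p < n) ((lab p == j)%:R - m.+1%:R^-1) * c e p) ^+ 2 <=
    \sum_(p < n) (m.+1%:R * \sum_e c e p ^+ 2).
Proof.
elim: n => [|n [lab IH]].
  exists (fun=> ord0); rewrite big_ord0 big1// => e _; rewrite big1// => j _.
  by rewrite big_ord0 expr0n.
pose dv e j := \sum_(p < n) ((lab p == j)%:R - m.+1%:R^-1) * c e p.
pose a (v : 'I_m.+1) e j : R := ((v == j)%:R - m.+1%:R^-1) * c e n.
have m1 : (m.+1%:R : R) != 0 by rewrite pnatr_eq0.
have a0 e j : \sum_v a v e j = 0.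
  rewrite -mulr_suml sumrB sumr_const card_ord -[_ *+ _]mulr_natr mulVf//.
  by rewrite (bigD1 j)//= eqxx big1 ?addr0 ?subrr ?mul0r// => v /negPf ->.
have [v va] : exists v, \sum_e \sum_j dv e j * a v e j <= 0.
  apply: contrapT => /forallNP na.
  have : 0 < \sum_v \sum_e \sum_j dv e j * a v e j.
    rewrite (bigD1 ord0)//= ltr_wpDr//.
      by apply: sumr_ge0 => v _; apply/ltW; rewrite ltNge; apply/negP; exact: na.
    by rewrite ltNge; apply/negP; exact: na.
  rewrite exchange_big big1 ?ltxx// => e _; rewrite exchange_big big1// => j _.
  by rewrite -mulr_sumr a0 mulr0.
exists (fun p => if p == n then v else lab p).
have E e j : \sum_(p < n.+1) (((if (p : nat) == n then v else lab p) == j)%:R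
    - m.+1%:R^-1) * c e p = dv e j + a v e j.
  rewrite big_ord_recr/= eqxx; congr (_ + _); apply: eq_bigr => p _.
  by rewrite (ltn_eqF (ltn_ord p)).
rewrite [leLHS](_ : _ = (\sum_e \sum_j dv e j ^+ 2) +
   2 * (\sum_e \sum_j dv e j * a v e j) + \sum_e \sum_j a v e j ^+ 2); last first.
  rewrite mulr_sumr -!big_split/=; apply: eq_bigr => e _.
  rewrite mulr_sumr -!big_split/=; apply: eq_bigr => j _.
  rewrite E; ring.
rewrite big_ord_recr/=; apply: lerD.
  rewrite -[leRHS]addr0; apply: lerD; first exact: IH.
  by rewrite pmulr_rle0.
rewrite mulr_sumr; apply: ler_sum => e _.
rewrite [leRHS](_ : _ = \sum_(j < m.+1) c e n ^+ 2); last first.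
  by rewrite sumr_const card_ord mulr_natl.
(* A crude bound: each coefficient has absolute value at most 1, so the [m.+1] labels cost [m.+1]
   squares. *)
apply: ler_sum => j _; rewrite /a exprMn ler_piMl ?sqr_ge0//.
have i0 : 0 <= (m.+1%:R : R)^-1 by rewrite invr_ge0.
have i1 : (m.+1%:R : R)^-1 <= 1 by rewrite invf_le1 ?ltr0n// ler1n.
move: (_^-1) i0 i1 => k k0 k1.
by case: (v == j); rewrite ?mulr1n ?mulr0n; nra.
Qed.

Section Mixing.
Context (d : measure_display) (Omega : measurableType d) (R : realType).
Variable P : probability Omega R.

(** Singletons are null, as a subset of a singleton cannot have a probability strictly between 0 and
    that of the singleton. Finite intersections of base neighbourhoods shrink to [y], so one of
    them, and then some base set inside it, has probability below [e]. *)
Lemma nonatomic_small_cover (T : topologicalType) (Y : Omega -> T) (e : R) :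
  polish R T -> random_var Y -> nonatomic_law P Y -> 0 < e ->
  exists Q : nat -> set T, [/\ forall i, open (Q i),
    forall i, pr P (Y @^-1` Q i) < e & forall y, exists i, Q i y].
Proof.
move=> pT mY nY e0; have T1 := polish_open_setC1 pT.
have [v [cv vB]] := polish_base pT.
have ov i : open [set y | 0 < v i y] by exact: continuous_open_pos.
have m1 y : measurable (Y @^-1` [set y]).
  by rewrite -[X in measurable X]setCK preimage_setC; apply/measurableC/mY/T1.
have pr1 y : pr P (Y @^-1` [set y]) = 0.
  apply/eqP; rewrite eq_le pr_ge0 andbT leNgt; apply/negP => p0.
  have [||B [_ By + +]] := nY [set y].
  - rewrite -[X in borel X]setCK.
    have sb : sigma_algebra setT (@borel T) by exact: smallest_sigma_algebra.
    by apply: (salgC sb); apply: sub_sigma_algebra; exact: T1.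
  - by rewrite (prE P (m1 y)) lte_fin.
  - by have [->|->] := subset_set1 By; rewrite ?preimage_set0 ?measure0 ltxx.
(* The small sets of the base; the others are replaced by the empty set to keep the indexing by
   [nat]. *)
exists (fun i => if pr P (Y @^-1` [set y | 0 < v i y]) < e
  then [set y | 0 < v i y] else set0); split.
- by move=> i; case: ifP => _; [exact: ov|exact: open0].
- by move=> i; case: ifP => //; rewrite preimage_set0 pr0.
move=> y.
pose K n := \big[setI/setT]_(i < n)
  (if 0 < v i y then [set z | 0 < v i z] else setT).
have KE n z : K n z <-> forall i, (i < n)%N -> 0 < v i y -> 0 < v i z.
  rewrite /K -(bigcap_mkord n (fun i => if 0 < v i y then [set z | 0 < v i z] else setT)).
  split=> [Kz i /Kz/=|Kz i /= /Kz]; first by case: ifP.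
  by case: ifP => // _; apply.
have oK n : open (K n).
  rewrite /K; apply: big_ind; [exact: openT|by move=> A B; exact: openI|].
  by move=> i _; case: ifP => _; [exact: ov|exact: openT].
pose F n := Y @^-1` K n `\` Y @^-1` [set y].
have mF n : measurable (F n) by apply: measurableD => //; exact: mY.
have [|w|n Hn] := pr_small_tail P mF _ _ e0.
- move=> p q pq w [/= /KE Kq nw]; split => //=; apply/KE => i ip.
  by apply: Kq; exact: leq_trans pq.
- have [wy|wy] := pselect (Y w = y); first by exists 0%N => -[_]; exact.
  have [i [vi viB]] := vB _ y (T1 (Y w)) (fun h => wy (esym h)).
  exists i.+1 => -[/= /KE /(_ i (leqnn _) vi) /viB yw _]; exact: yw.
have prK : pr P (Y @^-1` K n) < e.
  have KF : Y @^-1` K n `<=` F n `|` Y @^-1` [set y].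
    by move=> w Kw; have [wy|wy] := pselect (Y w = y); [right|left].
  apply: (le_lt_trans (le_pr _ _ _ KF)); first exact/mY.
    exact: measurableU.
  by apply: (le_lt_trans (pr_leU P (mF n) (m1 y))); rewrite pr1 addr0.
have [|i [vi viK]] := vB (K n) y (oK n); first exact/KE.
exists i; rewrite ifT// (le_lt_trans _ prK)//.
by apply: le_pr => //; [exact/mY|exact/mY/oK|move=> w /viK].
Qed.

(** [Y] is cut into disjoint cells of probability at most [del], the first [n] of which carry almost
    all the mass and receive labels from [balanced_labels]; [V j] collects the cells labelled [j].
    The squares of the masses [c i p] sum over [p] to at most [del], which makes every discrepancy
    small whatever the events [E] are. *)
Lemma mixing (T : topologicalType) (Y : Omega -> T) (F : set (set Omega))
    (J : finType) (E : J -> set Omega) (m : nat) (e : R) :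
  polish R T -> random_var Y -> nonatomic_law P Y ->
  sigma_algebra setT F -> F `<=` measurable -> meas_wrt F Y ->
  (forall i, measurable (E i)) -> 0 < e ->
  exists V : 'I_m.+1 -> set Omega, [/\ forall j, F (V j),
    forall i j w, V i w -> V j w -> i = j &
    forall i j, `|pr P (E i `&` V j) - pr P (E i) / m.+1%:R| < e].
Proof.
move=> pT mY nY sF Fm FY mE e0.
(* The squared discrepancies add up to at most [m.+1 * #|J| * del], which is thus below
   [(e / 2) ^+ 2]. The other [e / 2] pays for the unlabelled cells. *)
pose del := (e / 2) ^+ 2 / (m.+1%:R * #|J|.+1%:R).
have del0 : 0 < del by rewrite divr_gt0// ?exprn_gt0 ?mulr_gt0 ?divr_gt0 ?ltr0n.
have [Q [oQ Qdel Qcov]] := nonatomic_small_cover pT mY nY del0.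
pose C := seqDU (fun i => Y @^-1` Q i).
have FC i : F (C i).
  by rewrite /C /seqDU; apply: (salgD sF); [exact/FY|apply: salg_bigU => // j _; exact/FY].
have mC i : measurable (C i) by exact: Fm.
have tC i j w : C i w -> C j w -> i = j.
  by move=> Ci Cj; apply: (trivIset_seqDU (fun i => Y @^-1` Q i)) => //; exists w.
have Ccov : \bigcup_i C i = setT.
  rewrite -seqDU_bigcup_eq predeqE => w; split => // _.
  by have [i Qi] := Qcov (Y w); exists i.
have [n Hn] := pr_bigcup_tail P mC (divr_gt0 e0 (ltr0n _ 2)).
rewrite Ccov setTD in Hn.
pose c i p := pr P (E i `&` C p).
have [lab labP] := balanced_labels m n c.
pose V j := \big[setU/set0]_(p < n | lab p == j) C p.
have cdel i p : c i p <= del.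
  apply/ltW/(le_lt_trans _ (Qdel p))/le_pr; [exact: measurableI|exact/mY|].
  by move=> w [_ [] ].
have mEC i p : measurable (E i `&` C p) by exact: measurableI.
have tEC i (p q : 'I_n) w : (E i `&` C p) w -> (E i `&` C q) w -> p = q.
  by move=> [_ Cp] [_ Cq]; apply/val_inj; exact: tC Cp Cq.
have csum i : pr P (E i) = \sum_(p < n) c i p +
    pr P (E i `&` ~` \big[setU/set0]_(p < n) C p).
  have mU : measurable (\big[setU/set0]_(p < n) C p) by exact: bigsetU_measurable.
  rewrite (pr_split P (mE i) mU) big_distrr/=; congr (_ + _).
  by rewrite pr_bigU//; exact: tEC.
exists V; split.
- by move=> j; apply: salg_bigU => // p _; exact: FC.
- move=> i j w /bigsetUP[p [/eqP <- Cp]] /bigsetUP[q [/eqP <- Cq]].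
  by rewrite (tC _ _ _ Cp Cq).
- move=> i j.
  have -> : pr P (E i `&` V j) = \sum_(p < n) (lab p == j)%:R * c i p.
    rewrite /V big_distrr/= pr_bigU//; last exact: tEC.
    by rewrite big_mkcond/=; apply: eq_bigr => p _; case: eqP; rewrite ?mul1r ?mul0r.
  pose dv := \sum_(p < n) ((lab p == j)%:R - m.+1%:R^-1) * c i p.
  have restE : pr P (E i `&` ~` \big[setU/set0]_(p < n) C p) < e / 2.
    apply: le_lt_trans Hn; apply: le_pr => //.
      by apply: measurableI => //; apply: measurableC; exact: bigsetU_measurable.
    by apply: measurableC; exact: bigsetU_measurable.
  have dvE : \sum_(p < n) (lab p == j)%:R * c i p - pr P (E i) / m.+1%:R =
     dv - pr P (E i `&` ~` \big[setU/set0]_(p < n) C p) / m.+1%:R.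
    rewrite csum mulrDl opprD addrA; congr (_ - _); rewrite /dv.
    under [RHS]eq_bigr do rewrite mulrBl.
    by rewrite sumrB -mulr_sumr mulrC.
  have dv2 : dv ^+ 2 < (e / 2) ^+ 2.
    apply: (@le_lt_trans _ _ (m.+1%:R * #|J|%:R * del)); last first.
      rewrite /del mulrCA -[ltRHS]mulr1 ltr_pM2l ?exprn_gt0 ?divr_gt0//.
      by rewrite ltr_pdivrMr ?mulr_gt0 ?ltr0n// mul1r ltr_pM2l ?ltr0n// ltr_nat.
    apply: (@le_trans _ _ (\sum_(p < n) (m.+1%:R * \sum_e c e p ^+ 2))).
      apply: le_trans labP; rewrite (bigD1 i)//= (bigD1 j)//= -addrA ler_wpDr//.
      by apply: addr_ge0; apply: sumr_ge0 => *; rewrite ?sqr_ge0//; apply: sumr_ge0 => *;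
        rewrite sqr_ge0.
    rewrite -mulr_sumr -mulrA ler_pM2l ?ltr0n// exchange_big/= -sum1_card natr_sum mulr_suml.
    apply: ler_sum => k _; rewrite mul1r.
    apply: (@le_trans _ _ (\sum_(p < n) del * c k p)).
      by apply: ler_sum => p _; rewrite expr2 ler_wpM2r// pr_ge0.
    rewrite -mulr_sumr ler_piMr ?(ltW del0)//.
    by apply: le_trans (pr_le1 P (mE k)); rewrite csum lerDl pr_ge0.
  have dv1 : `|dv| < e / 2.
    have e20 : 0 <= e / 2 by rewrite ltW ?divr_gt0.
    by rewrite -ltr_sqr ?nnegrE ?normr_ge0// real_normK ?num_real.
  have r0 : 0 <= pr P (E i `&` ~` \big[setU/set0]_(p < n) C p) / m.+1%:R.
    by rewrite divr_ge0 ?pr_ge0.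
  have r1 : pr P (E i `&` ~` \big[setU/set0]_(p < n) C p) / m.+1%:R < e / 2.
    apply: le_lt_trans restE; rewrite ler_pdivrMr ?ltr0n// ler_peMr ?pr_ge0//.
    by rewrite ler1n.
  rewrite dvE; apply: (le_lt_trans (ler_normB _ _)).
  by rewrite (splitr e) ltrD// ger0_norm.
Qed.

End Mixing.

(** * Expectations and conditional probabilities *)

(** The sum counts the naturals below [y], so it is the ceiling of [y]; the bound by [M] ensures
    that none is missed. *)
Lemma count_lt_bounds (R : realDomainType) (M : nat) (y : R) :
  0 <= y <= M%:R ->
  y <= \sum_(j < M) (j%:R < y)%R%:R <= y + 1.
Proof.
elim: M => [|M IH] /andP[y0 yM]; first by rewrite big_ord0; lra.
rewrite big_ord_recr/=; have [My|yM'] := ltP M%:R y.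
  rewrite (eq_bigr (fun=> 1)) => [|j _]; last first.
    by rewrite (le_lt_trans _ My)// ler_nat ltnW.
  rewrite sumr_const card_ord /=; move: yM; rewrite -natr1; lra.
by rewrite addr0; apply: IH; rewrite y0.
Qed.

(** Applied pointwise, this writes a function with values in [[0, 1]] as the average of the
    indicators of [m.+1] superlevel sets, with uniform error [1 / m.+1]. It serves as the
    simple-function approximation throughout. *)
Lemma layer_cake (R : realFieldType) (m : nat) (x : R) : 0 <= x <= 1 ->
  x <= m.+1%:R^-1 * \sum_(j < m.+1) (j%:R < m.+1%:R * x)%R%:R <= x + m.+1%:R^-1.
Proof.
move=> /andP[x0 x1]; have m0 : (0 : R) < m.+1%:R by rewrite ltr0n.
have /andP[h1 h2] : m.+1%:R * x <= \sum_(j < m.+1) (j%:R < m.+1%:R * x)%R%:R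
    <= m.+1%:R * x + 1.
  apply: count_lt_bounds; rewrite mulr_ge0 ?(ltW m0)//=.
  by rewrite -[leRHS]mulr1 ler_wpM2l ?(ltW m0).
rewrite ler_pdivlMl// h1/= ler_pdivrMl// mulrDr divff ?gt_eqF//.
Qed.

Section Expectation.
Context (d : measure_display) (Omega : measurableType d) (R : realType).
Variable P : probability Omega R.
Implicit Types f g h : Omega -> R.

Definition Ex f : R := \int[P]_x f x.

Definition bounded_mfun f := measurable_fun setT f /\ exists c, forall x, `|f x| <= c.

Lemma bm_int f : bounded_mfun f -> P.-integrable setT (EFin \o f).
Proof.
move=> [mf [c fc]]; apply: measurable_bounded_integrable => //.
  by rewrite -ge0_fin_numE ?fin_num_measure.
by exists c; split; [exact: num_real|move=> x cx y _; rewrite /= (le_trans (fc y))// ltW].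
Qed.

Lemma bounded_mfun_cst (c : R) : bounded_mfun (fun=> c).
Proof. by split; [exact: measurable_cst|exists `|c|]. Qed.

Lemma bounded_mfun_indic A : measurable A -> bounded_mfun \1_A.
Proof.
move=> mA; split; first exact/measurable_realfun.measurable_indicP.
by exists 1 => x; rewrite indicE; case: (_ \in _); rewrite ?normr1 ?normr0.
Qed.

Lemma bounded_mfunD f g : bounded_mfun f -> bounded_mfun g -> bounded_mfun (fun x => f x + g x).
Proof.
move=> [mf [c fc]] [mg [c' gc]]; split; first exact: measurable_funD.
by exists (c + c') => x; apply: (le_trans (ler_normD _ _)); apply: lerD.
Qed.

Lemma bounded_mfunM f g : bounded_mfun f -> bounded_mfun g -> bounded_mfun (fun x => f x * g x).
Proof.
move=> [mf [c fc]] [mg [c' gc]]; split; first exact: measurable_funM.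
by exists (c * c') => x; rewrite normrM ler_pM.
Qed.

Lemma bounded_mfunZ (c : R) f : bounded_mfun f -> bounded_mfun (fun x => c * f x).
Proof. by move=> bf; apply: bounded_mfunM => //; exact: bounded_mfun_cst. Qed.

Lemma bounded_mfunB f g : bounded_mfun f -> bounded_mfun g -> bounded_mfun (fun x => f x - g x).
Proof.
move=> [mf [c fc]] [mg [c' gc]]; split; first exact: measurable_funB.
by exists (c + c') => x; apply: (le_trans (ler_normB _ _)); apply: lerD.
Qed.

Lemma bounded_mfun_sum (I : Type) (r : seq I) (F : I -> Omega -> R) :
  (forall i, bounded_mfun (F i)) -> bounded_mfun (fun x => \sum_(i <- r) F i x).
Proof.
move=> bF; elim: r => [|i r IH].
  by under eq_fun do rewrite big_nil; exact: bounded_mfun_cst.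
by under eq_fun do rewrite big_cons; exact: bounded_mfunD.
Qed.

Lemma bounded_mfun_01 f : measurable_fun setT f -> (forall x, 0 <= f x <= 1) -> bounded_mfun f.
Proof.
by move=> mf f01; split => //; exists 1 => x; have /andP[f0 f1] := f01 x;
  rewrite ger0_norm.
Qed.

Lemma ExD f g : bounded_mfun f -> bounded_mfun g -> Ex (fun x => f x + g x) = Ex f + Ex g.
Proof. by move=> bf bg; rewrite /Ex RintegralD//; exact: bm_int. Qed.

Lemma ExB f g : bounded_mfun f -> bounded_mfun g -> Ex (fun x => f x - g x) = Ex f - Ex g.
Proof. by move=> bf bg; rewrite /Ex RintegralB//; exact: bm_int. Qed.

Lemma ExZ c f : bounded_mfun f -> Ex (fun x => c * f x) = c * Ex f.
Proof. by move=> bf; rewrite /Ex RintegralZl//; exact: bm_int. Qed.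

Lemma Ex_sum (I : Type) (r : seq I) (F : I -> Omega -> R) :
  (forall i, bounded_mfun (F i)) -> Ex (fun x => \sum_(i <- r) F i x) = \sum_(i <- r) Ex (F i).
Proof.
move=> bF; elim: r => [|i r IH].
  under [X in Ex X]eq_fun do rewrite big_nil.
  by rewrite big_nil /Ex Rintegral_cst// mul0r.
under [X in Ex X]eq_fun do rewrite big_cons.
by rewrite ExD ?big_cons ?IH//; exact: bounded_mfun_sum.
Qed.

Lemma Ex_le f g : bounded_mfun f -> bounded_mfun g -> (forall x, f x <= g x) -> Ex f <= Ex g.
Proof. by move=> bf bg fg; apply: le_Rintegral => //; exact: bm_int. Qed.

Lemma Ex_cst c : Ex (fun=> c) = c.
Proof. by rewrite /Ex Rintegral_cst// [fine _]prT mulr1. Qed.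

Lemma Ex_indic A : measurable A -> Ex \1_A = pr P A.
Proof. by move=> mA; rewrite /Ex /Rintegral integral_indic// setIT. Qed.

Lemma Ex_dist f g c : bounded_mfun f -> bounded_mfun g -> (forall x, `|f x - g x| <= c) ->
  `|Ex f - Ex g| <= c.
Proof.
move=> bf bg fg; rewrite ler_distl; apply/andP; split.
  rewrite -[c]Ex_cst -ExB//; last exact: bounded_mfun_cst.
  apply: Ex_le => //; first by apply: bounded_mfunB => //; exact: bounded_mfun_cst.
  by move=> x; have := fg x; rewrite ler_distl => /andP[].
rewrite -[c]Ex_cst -ExD//; last exact: bounded_mfun_cst.
apply: Ex_le => //; first by apply: bounded_mfunD => //; exact: bounded_mfun_cst.
by move=> x; have := fg x; rewrite ler_distl => /andP[].
Qed.

(** Used to exchange the indicator of an event for its Lusin function. *)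
Lemma Ex_dist_off f g E : bounded_mfun f -> bounded_mfun g -> measurable E ->
  (forall x, `|f x - g x| <= 1) -> (forall x, ~ E x -> f x = g x) ->
  `|Ex f - Ex g| <= pr P E.
Proof.
move=> bf bg mE fg1 fgE; have bE := bounded_mfun_indic mE.
have fg x : `|f x - g x| <= \1_E x.
  rewrite indicE; have [xE|xE] := boolP (x \in E); first exact: fg1.
  by rewrite fgE ?subrr ?normr0// => Ex; move: xE; rewrite notin_setE.
rewrite ler_distl -Ex_indic//; apply/andP; split.
  rewrite -ExB//; apply: Ex_le => //; first exact: bounded_mfunB.
  by move=> x; have := fg x; rewrite ler_distl => /andP[].
rewrite -ExD//; apply: Ex_le => //; first exact: bounded_mfunD.
by move=> x; have := fg x; rewrite ler_distl => /andP[].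
Qed.

Lemma Ex_restrict f C : bounded_mfun f -> measurable C ->
  (\int[P]_(x in C) (f x)%:E)%E = (Ex (fun x => f x * \1_C x))%:E.
Proof.
move=> bf mC; rewrite /Ex /Rintegral fineK; last first.
  apply: integrable_fin_num => //.
  by apply: bm_int; apply: bounded_mfunM => //; exact: bounded_mfun_indic.
rewrite [LHS]integral_mkcond; apply: eq_integral => x _.
rewrite patchE indicE; case: ifP => _; by rewrite ?mulr1 ?mulr0.
Qed.

Lemma int_gt0_null f C : P.-integrable setT (EFin \o f) -> measurable C ->
  (forall x, C x -> 0 < f x) -> (\int[P]_(x in C) (f x)%:E <= 0)%E -> P C = 0%E.
Proof.
move=> intf mC fC0 int0.
have mf : measurable_fun setT (EFin \o f) by exact: measurable_int intf.
have : (\int[P]_(x in C) `|(EFin \o f) x| = 0)%E.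
  apply/eqP; rewrite eq_le integral_ge0// andbT; apply: le_trans int0.
  rewrite (@eq_integral _ _ _ P C (EFin \o f))// => x /set_mem Cx /=.
  by rewrite ger0_norm// ltW// fC0.
move/(ae_eq_integral_abs P mC (measurable_funTS mf)) => [N [mN N0 CN]].
apply/eqP; rewrite eq_le measure_ge0 andbT -N0 le_measure ?inE//.
by move=> x Cx; apply: CN => /= /(_ Cx) /= [] fx; have := fC0 x Cx; rewrite fx ltxx.
Qed.

End Expectation.

(** * Conditional probabilities given a sub-sigma-algebra *)

Section SubSigmaAlgebra.
Context (d : measure_display) (Omega : measurableType d) (R : realType).
Variable P : probability Omega R.
Variable F : set (set Omega).
Hypotheses (sF : sigma_algebra setT F) (Fm : F `<=` measurable).
Implicit Types f g h : Omega -> R.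

Definition F_fun f := forall B : set R, measurable B -> F (f @^-1` B).

(** Working form of [cond_prob_version]: bounds that hold everywhere, not just almost everywhere,
    keep all products bounded, and the defining identity is between real numbers. *)
Definition version A g := [/\ F_fun g, forall x, 0 <= g x <= 1 &
  forall C, F C -> Ex P (fun x => g x * \1_C x) = pr P (A `&` C)].

Lemma F_funP f : F_fun f <-> measurable_fun setT (f : g_sigma_algebraType F -> R).
Proof.
split=> [mf _ B mB|mf B mB].
  by rewrite setTI; apply: sub_sigma_algebra; exact: mf.
have := mf measurableT B mB; rewrite setTI.
by rewrite /measurable/= (sigma_algebra_id sF).
Qed.

Lemma F_fun_measurable f : F_fun f -> measurable_fun setT f.
Proof. by move=> mf _ B mB; rewrite setTI; exact/Fm/mf. Qed.

Lemma version_bounded A g : version A g -> bounded_mfun g.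
Proof. by move=> [/F_fun_measurable mg g01 _]; exact: bounded_mfun_01. Qed.

(** The superlevel sets of [h] lie in [F], so the two sides agree exactly when [h] is replaced by
    its layer-cake average [hm m]; the replacement costs a constant over [m.+1]. *)
Lemma pull_out f1 f2 h : bounded_mfun f1 -> bounded_mfun f2 ->
  (forall C, F C -> Ex P (fun x => f1 x * \1_C x) = Ex P (fun x => f2 x * \1_C x)) ->
  F_fun h -> (forall x, 0 <= h x <= 1) ->
  Ex P (fun x => h x * f1 x) = Ex P (fun x => h x * f2 x).
Proof.
move=> b1 b2 f12 Fh h01.
have bh : bounded_mfun h by apply: bounded_mfun_01 => //; exact: F_fun_measurable.
pose C m (j : nat) := [set x | j%:R < m.+1%:R * h x].
have FC m j : F (C m j).
  rewrite (_ : C m j = h @^-1` `]j%:R / m.+1%:R, +oo[%classic).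
    by apply: Fh; exact: measurable_itv.
  rewrite predeqE => x; rewrite /C /= in_itv/= andbT.
  by rewrite ltr_pdivrMr ?ltr0n// mulrC.
pose hm (m : nat) (x : Omega) : R := m.+1%:R^-1 * \sum_(j < m.+1) \1_(C m j) x.
have hmE m x : h x <= hm m x <= h x + m.+1%:R^-1.
  have := layer_cake m (h01 x); rewrite /hm.
  rewrite (eq_bigr (fun j : 'I_m.+1 => \1_(C m j) x)) // => j _.
  rewrite indicE; congr ((nat_of_bool _)%:R); apply/idP/idP; by rewrite inE.
have bI m j : bounded_mfun (\1_(C m j) : _ -> R) by apply/bounded_mfun_indic/Fm/FC.
have bhm m : bounded_mfun (hm m) by apply: bounded_mfunZ; apply: bounded_mfun_sum => j; exact: bI.
have Ehm m f : bounded_mfun f -> Ex P (fun x => hm m x * f x) =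
    m.+1%:R^-1 * \sum_(j < m.+1) Ex P (fun x => f x * \1_(C m j) x).
  move=> bf; rewrite -Ex_sum; last by move=> j; exact: bounded_mfunM.
  rewrite -ExZ; last by apply: bounded_mfun_sum => j; exact: bounded_mfunM.
  congr Ex; apply/funext => x; rewrite /hm -mulrA; congr (_ * _).
  by rewrite mulr_suml; apply: eq_bigr => j _; rewrite mulrC.
have close f : bounded_mfun f -> exists c, 0 <= c /\ forall m,
    `|Ex P (fun x => h x * f x) - Ex P (fun x => hm m x * f x)| <= c / m.+1%:R.
  move=> bf; have [_ [c fc]] := bf; exists `|c|; split => // m.
  apply: Ex_dist; [exact: bounded_mfunM|exact: bounded_mfunM|move=> x].
  rewrite -mulrBl normrM mulrC ler_pM//.
    exact: le_trans (fc x) (ler_norm c).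
  have /andP[hm1 hm2] := hmE m x.
  by rewrite distrC ger0_norm ?subr_ge0// lerBlDl.
have [c1 [c10 H1]] := close _ b1; have [c2 [c20 H2]] := close _ b2.
apply/eqP; rewrite -subr_eq0 -normr_eq0 eq_le normr_ge0 andbT.
apply/ler_addgt0Pr => e e0; rewrite add0r.
pose m := Num.trunc ((c1 + c2) / e).
have He : Ex P (fun x => hm m x * f1 x) = Ex P (fun x => hm m x * f2 x).
  by rewrite !Ehm//; congr (_ * _); apply: eq_bigr => j _; exact: f12.
apply: (@le_trans _ _ (c1 / m.+1%:R + c2 / m.+1%:R)).
  rewrite -(subrK (Ex P (fun x => hm m x * f1 x)) (Ex P (fun x => h x * f1 x))).
  rewrite -addrA; apply: (le_trans (ler_normD _ _)); apply: lerD; first exact: H1.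
  by rewrite He distrC; exact: H2.
rewrite -mulrDl ler_pdivrMr ?ltr0n// -ler_pdivrMl// mulrC.
by apply/ltW; exact: truncnS_gt.
Qed.

(** The events [g < 0] and [1 < g] lie in [F]. Integrating [- g] over the first and [g - 1] over the
    second gives at most 0, so both are null and clamping changes [g] only on a null set. *)
Lemma version_clamp A g : measurable A -> cond_prob_version P F A g ->
  exists g', version A g' /\ {ae P, forall x, g x = g' x}.
Proof.
move=> mA [Fg intg gE].
have intS C : measurable C -> P.-integrable C (EFin \o g).
  by move=> mC; apply: (integrableS measurableT).
have Fg0 : F [set x | g x < 0].
  rewrite (_ : [set x | _] = g @^-1` `]-oo, 0[%classic); first by apply: Fg; exact: measurable_itv.
  by rewrite predeqE => x; rewrite /= in_itv.
have Fg1 : F [set x | 1 < g x].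
  rewrite (_ : [set x | _] = g @^-1` `]1, +oo[%classic); first by apply: Fg; exact: measurable_itv.
  by rewrite predeqE => x; rewrite /= in_itv/= andbT.
have N0 : P [set x | g x < 0] = 0%E.
  apply: (@int_gt0_null _ _ _ P (fun x => - g x)) => //.
  - by rewrite (_ : EFin \o _ = (fun x => - (EFin \o g) x)%E)//; exact: integrableN.
  - exact: Fm.
  - by move=> x /=; rewrite oppr_gt0.
  - rewrite (eq_integral (fun x => - (EFin \o g) x)%E)//.
    rewrite integralN/=; last first.
      exact: (integrable_add_def (Fm Fg0) (intS _ (Fm Fg0))).
    by rewrite gE// oppe_le0.
have N1 : P [set x | 1 < g x] = 0%E.
  have int1 : P.-integrable [set: Omega] (EFin \o (fun=> 1 : R)) by exact/bm_int/bounded_mfun_cst.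
  apply: (@int_gt0_null _ _ _ P (fun x => g x - 1)) => //.
  - rewrite (_ : EFin \o _ = ((EFin \o g) \- (EFin \o (fun=> 1%R : R)))%E)//.
    exact: integrableB.
  - exact: Fm.
  - by move=> x /=; rewrite subr_gt0.
  - rewrite (eq_integral ((EFin \o g) \- (EFin \o (fun=> 1%R : R)))%E)//.
    have mC := Fm Fg1.
    rewrite integralB//=; [|exact: intS|by apply: (integrableS measurableT)].
    rewrite gE// integral_cst// mul1e sube_le0 le_measure ?inE//.
    exact: measurableI.
pose g' x := Num.min 1 (Num.max 0 (g x)).
have g'01 x : 0 <= g' x <= 1.
  by rewrite /g' le_min ler01 le_max lexx ge_min lexx.
have Fg' : F_fun g'.
  apply/F_funP; have /F_funP mg := Fg.
  apply: measurable_minr => //; apply: measurable_maxr => //.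
have gg' : {ae P, forall x, g x = g' x}.
  exists ([set x | g x < 0] `|` [set x | 1 < g x]); split.
  - by apply: measurableU; exact: Fm.
  - by rewrite measureU0//; exact: Fm.
  - move=> x /= nE; apply: contrapT => /not_orP[/negP + /negP].
    by rewrite -!leNgt => g0 g1; apply: nE; rewrite /g' max_r// min_r.
have bg' : bounded_mfun g' by apply: bounded_mfun_01 => //; exact: F_fun_measurable.
exists g'; split => //; split => // C FC.
apply: EFin_inj; rewrite -Ex_restrict//; last exact: Fm.
rewrite -prE; last by apply: measurableI => //; exact: Fm.
rewrite -gE//; apply: ae_eq_integral.
- exact: Fm.
- by apply/measurable_EFinP; apply: measurable_funTS; case: bg'.
- by apply: measurable_funTS; exact: measurable_int intg.
- case: gg' => N [mN PN0 gN]; exists N; split => // x /= h.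
  by apply: gN => /= e; apply: h => _; rewrite e.
Qed.

End SubSigmaAlgebra.

(** Restricted to [F], this is the measure whose density with respect to the restriction of [P] is
    the conditional probability of [A]. The proofs are arguments so that the measure structure can
    be inferred from the term. *)
Definition cond_measure d (Omega : measurableType d) (R : realType)
    (P : probability Omega R) (F : set (set Omega))
    (sF : sigma_algebra setT F) (Fm : F `<=` measurable)
    (A : set Omega) (mA : measurable A) (C : set (g_sigma_algebraType F)) : \bar R :=
  P (A `&` (C : set Omega)).

Section CondMeasure.
Context (d : measure_display) (Omega : measurableType d) (R : realType).
Variable P : probability Omega R.
Variable F : set (set Omega).
Hypotheses (sF : sigma_algebra setT F) (Fm : F `<=` measurable).
Variables (A : set Omega) (mA : measurable A).
Local Notation mu := (cond_measure P sF Fm mA).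

Let mF (C : set (g_sigma_algebraType F)) : measurable C -> measurable (C : set Omega).
Proof. by rewrite {1}/measurable/= (sigma_algebra_id sF); exact: Fm. Qed.

Let mu0 : mu set0 = 0%E.
Proof. by rewrite /cond_measure setI0 measure0. Qed.

Let mu_ge0 C : (0 <= mu C)%E. Proof. exact: measure_ge0. Qed.

Let mu_sigma : semi_sigma_additive mu.
Proof.
move=> G mG tG mU; rewrite /cond_measure setI_bigcupr.
apply: measure_semi_sigma_additive => //.
- by move=> i; apply: measurableI => //; exact: mF.
- apply/trivIsetP => i j _ _ ij; move/trivIsetP : tG => /(_ i j Logic.I Logic.I ij).
  by rewrite setIACA => ->; rewrite setI0.
- by rewrite -setI_bigcupr; apply: measurableI => //; exact: mF.
Qed.

HB.instance Definition _ := isMeasure.Build _ _ _ mu mu0 mu_ge0 mu_sigma.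

Let mu_fin : fin_num_fun mu.
Proof. by move=> C mC; apply: fin_num_measure; apply: measurableI => //; exact: mF. Qed.

HB.instance Definition _ := @Measure_isFinite.Build _ _ _ mu mu_fin.

End CondMeasure.

Section Versions.
Context (d : measure_display) (Omega : measurableType d) (R : realType).
Variable P : probability Omega R.
Variable F : set (set Omega).
Hypotheses (sF : sigma_algebra setT F) (Fm : F `<=` measurable).

Let idF : Omega -> g_sigma_algebraType F := id.

Let midF : measurable_fun setT idF.
Proof.
by move=> _ C; rewrite setTI {1}/measurable/= (sigma_algebra_id sF); exact: Fm.
Qed.

(** The Radon-Nikodym derivative on [F] of the measure of [A] against that of [setT]. Without
    existence, [cond_indep] could not be exploited, since it only speaks of given versions. *)
Lemma cond_prob_exists A : measurable A -> exists g, cond_prob_version P F A g.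
Proof.
move=> mA.
have FE : F.-sigma.-measurable = F by exact: sigma_algebra_id.
have dom : cond_measure P sF Fm mA `<< cond_measure P sF Fm measurableT.
  apply/null_content_dominatesP => C mC PC.
  have PC0 : P C = 0%E by rewrite -(setTI C); exact: PC.
  suff : P (A `&` C) = 0%E by [].
  have mC' : measurable (C : set Omega) by apply: Fm; rewrite -FE.
  apply/eqP; rewrite eq_le measure_ge0 andbT -PC0 le_measure ?inE//.
  exact: measurableI.
have [f [f0 ffin fint fE]] := radon_nikodym_sigma_finite dom.
have mf : measurable_fun setT f by exact: measurable_int fint.
have intE C : F C -> (\int[P]_(x in C) f x)%E = P (A `&` C).
  move=> FC; have mC : F.-sigma.-measurable C by rewrite FE.
  transitivity (\int[cond_measure P sF Fm measurableT]_(x in C) f x)%E; last first.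
    exact: (esym (fE C mC)).
  (* The identity [idF], seen as a map onto the coarser measurable space, moves the integral from
     [F] back to [Omega]. *)
  transitivity (\int[pushforward P idF]_(x in C) f x)%E.
    by rewrite ge0_integral_pushforward//; exact: measurable_funTS.
  by apply: eq_measure_integral => B mB _; transitivity (P (setT `&` B)); [rewrite setTI|].
have fineE : EFin \o (fine \o f) = f by apply/funext => x /=; rewrite fineK.
have mfO : measurable_fun setT (f : Omega -> \bar R).
  exact: (measurableT_comp mf midF).
exists (fine \o f); split.
- by apply/(F_funP sF); exact: measurableT_comp.
- rewrite fineE; apply/integrableP; split => //.
  rewrite (eq_integral (fun x : Omega => f x)); last by move=> x _; rewrite gee0_abs.
  have := intE setT (salgT sF); rewrite setIT => ->.
  by rewrite -ge0_fin_numE// fin_num_measure.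
- by move=> C FC; rewrite -intE//; apply: eq_integral => x _; rewrite /= fineK.
Qed.

Lemma version_exists A : measurable A -> exists g, version P F A g.
Proof.
move=> mA; have [g gv] := cond_prob_exists mA.
by have [g' []] := version_clamp sF Fm mA gv; exists g'.
Qed.

Lemma version_cond_prob A g : measurable A -> version P F A g ->
  cond_prob_version P F A g.
Proof.
move=> mA gv; have bg := version_bounded Fm gv; have [Fg _ gE] := gv; split => //.
  exact: bm_int.
move=> C FC; rewrite Ex_restrict//; last exact: Fm.
by rewrite gE// prE//; apply: measurableI => //; exact: Fm.
Qed.

Lemma Ex_ae (f g : Omega -> R) : bounded_mfun f -> bounded_mfun g -> {ae P, forall x, f x = g x} ->
  Ex P f = Ex P g.
Proof.
move=> [mf _] [mg _] [N [mN PN0 fgN]]; rewrite /Ex /Rintegral; congr fine.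
apply: ae_eq_integral => //; [exact/measurable_EFinP|exact/measurable_EFinP|].
by exists N; split => // x /= h; apply: fgN => /= e; apply: h => _; rewrite e.
Qed.

(** The event [g < f] belongs to [F]; there [f - g] is positive with integral 0, so the event is
    null. The same holds with the roles exchanged. *)
Lemma F_fun_ae_unique (f g : Omega -> R) : bounded_mfun f -> bounded_mfun g ->
  F_fun F f -> F_fun F g ->
  (forall C, F C -> Ex P (fun x => f x * \1_C x) = Ex P (fun x => g x * \1_C x)) ->
  {ae P, forall x, f x = g x}.
Proof.
have half (f1 f2 : Omega -> R) : bounded_mfun f1 -> bounded_mfun f2 -> F_fun F f1 -> F_fun F f2 ->
    (forall C, F C -> Ex P (fun x => f1 x * \1_C x) = Ex P (fun x => f2 x * \1_C x)) ->
    F [set x | f2 x < f1 x] /\ P [set x | f2 x < f1 x] = 0%E.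
  move=> b1 b2 /(F_funP sF) F1 /(F_funP sF) F2 E12.
  have FC : F [set x | f2 x < f1 x].
    have /(F_funP sF) h : measurable_fun setT
      ((fun x => f1 x - f2 x) : g_sigma_algebraType F -> R) by exact: measurable_funB.
    have := h `]0, +oo[%classic (measurable_itv _).
    by congr F; rewrite predeqE => x; rewrite /= in_itv/= andbT subr_gt0.
  split=> //; apply: (@int_gt0_null _ _ _ P (fun x => f1 x - f2 x)).
  - exact/bm_int/bounded_mfunB.
  - exact: Fm.
  - by move=> x /=; rewrite subr_gt0.
  - rewrite Ex_restrict//; [|exact: bounded_mfunB|exact: Fm].
    have bC := bounded_mfun_indic R (Fm FC).
    rewrite (_ : (fun x => _) = (fun x => f1 x * \1_[set x | f2 x < f1 x] x
        - f2 x * \1_[set x | f2 x < f1 x] x)); last by apply/funext => x; rewrite mulrBl.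
    by rewrite ExB ?E12 ?subrr//; exact: bounded_mfunM.
move=> bf bg Ff Fg fg.
have [F1 P1] := half f g bf bg Ff Fg fg.
have [F2 P2] := half g f bg bf Fg Ff (fun C FC => esym (fg C FC)).
exists ([set x | g x < f x] `|` [set x | f x < g x]); split.
- by apply: measurableU; exact: Fm.
- by rewrite measureU0//; exact: Fm.
- move=> x /= nE; apply: contrapT => /not_orP[/negP + /negP].
  by rewrite -!leNgt => h1 h2; apply: nE; apply/le_anti; rewrite h1 h2.
Qed.

End Versions.

(** * Conditional independence as measurability of a conditional probability *)

Section Causal.
Context (d : measure_display) (Omega : measurableType d) (R : realType).
Variable P : probability Omega R.
Variables F G H : set (set Omega).
Hypotheses (sF : sigma_algebra setT F) (Fm : F `<=` measurable).
Hypotheses (Gm : G `<=` measurable) (sH : sigma_algebra setT H).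
Hypotheses (Hm : H `<=` measurable) (FH : F `<=` H).

Lemma F_fun_indic C : F C -> F_fun F (\1_C : Omega -> R).
Proof.
move=> FC; apply/(F_funP sF).
apply/(@measurable_indicP _ (g_sigma_algebraType F)).
by apply: sub_sigma_algebra.
Qed.

Lemma F_funM (f g : Omega -> R) : F_fun F f -> F_fun F g -> F_fun F (fun x => f x * g x).
Proof. by move=> /(F_funP sF) mf /(F_funP sF) mg; apply/(F_funP sF); exact: measurable_funM. Qed.

Lemma indicM (C D : set Omega) x : \1_C x * \1_D x = \1_(C `&` D) x :> R.
Proof. by rewrite indicI. Qed.

(** With [gB] and [gAB] the conditional probabilities of [B] and of the intersection, E[g 1_B] =
    E[g gB] because [g] is [F]-measurable; this equals E[gAB] by conditional independence, hence the
    probability of the intersection. *)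
Lemma cond_indep_causal : cond_indep P G H F -> forall A, G A ->
  exists g, version P F A g /\
    forall B, H B -> Ex P (fun x => g x * \1_B x) = pr P (A `&` B).
Proof.
move=> ci A GA; have mA := Gm GA.
have [g gv] := version_exists P sF Fm mA; exists g; split => // B HB.
have mB := Hm HB; have mAB : measurable (A `&` B) by exact: measurableI.
have [gB gBv] := version_exists P sF Fm mB.
have [gAB gABv] := version_exists P sF Fm mAB.
have ae := ci A B GA HB g gB gAB (version_cond_prob Fm mA gv)
  (version_cond_prob Fm mB gBv) (version_cond_prob Fm mAB gABv).
have bg := version_bounded Fm gv; have bgB := version_bounded Fm gBv.
have bgAB := version_bounded Fm gABv.
have [Fg g01 gE] := gv; have [FgB gB01 gBE] := gBv; have [FgAB _ gABE] := gABv.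
transitivity (Ex P (fun x => g x * gB x)).
  symmetry; apply: (pull_out Fm bgB (bounded_mfun_indic R mB)) => // C FC.
  rewrite gBE// -Ex_indic; last by apply: measurableI => //; exact: Fm.
  by congr Ex; apply/funext => x; rewrite indicM.
rewrite -(Ex_ae _ _ ae)//; last exact: bounded_mfunM.
have := gABE _ (salgT sF); rewrite setIT => <-.
by congr Ex; apply/funext => x; rewrite indicE in_setT mulr1.
Qed.

(** The hypothesis conditions [B], not [A]: this is the form that survives limits in law of adapted
    processes. Uniqueness of [F]-measurable densities turns it into the product formula. *)
Lemma causal_cond_indep :
  (forall A B g, G A -> H B -> version P F B g ->
     pr P (A `&` B) = Ex P (fun x => g x * \1_A x)) ->
  cond_indep P G H F.
Proof.
move=> causal A B GA HB gA gB gAB vA vB vAB.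
have mA := Gm GA; have mB := Hm HB.
have mAB : measurable (A `&` B) by exact: measurableI.
have [hA [hAv eA]] := version_clamp sF Fm mA vA.
have [hB [hBv eB]] := version_clamp sF Fm mB vB.
have [hAB [hABv eAB]] := version_clamp sF Fm mAB vAB.
have bA := version_bounded Fm hAv; have bB := version_bounded Fm hBv.
have bAB := version_bounded Fm hABv.
have [FA A01 hAE] := hAv; have [FB B01 hBE] := hBv; have [FAB _ hABE] := hABv.
have ae : {ae P, forall x, hAB x = hA x * hB x}.
  apply: (F_fun_ae_unique sF Fm) => //; [exact: bounded_mfunM|exact: F_funM|move=> C FC].
  have mC := Fm FC.
  (* The hypothesis is used for the intersection of [B] and [C], which is in [H] as [F] is contained
     in [H]; [hB] times the indicator of [C] is a version for it. *)
  rewrite hABE// -setIA (causal _ _ (fun x => hB x * \1_C x)) => //; last first.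
  - split.
    + by apply: F_funM => //; exact: F_fun_indic.
    + by move=> x; rewrite indicE; case: (_ \in _); rewrite ?mulr1 ?mulr0 ?lexx ?ler01.
    + move=> D FD; rewrite -setIA -hBE; last exact: salgI.
      by congr Ex; apply/funext => x; rewrite -mulrA indicM.
  - by apply: (salgI sH) => //; exact: FH.
  rewrite (_ : (fun x => hA x * hB x * \1_C x) = fun x => (hB x * \1_C x) * hA x); last first.
    by apply/funext => x; ring.
  symmetry; apply: (@pull_out _ _ _ P F Fm _ _ (fun x => hB x * \1_C x) bA
    (bounded_mfun_indic R mA)) => //.
  - move=> D FD; rewrite hAE// -Ex_indic; last by apply: measurableI => //; exact: Fm.
    by congr Ex; apply/funext => x; rewrite indicM.
  - by apply: F_funM => //; exact: F_fun_indic.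
  - by move=> x; rewrite indicE; case: (_ \in _); rewrite ?mulr1 ?mulr0 ?lexx ?ler01.
have aeF : Filter (nbhs (almost_everywhere P)) := ae_filter_ringOfSetsType P.
apply: (filterS _ (filterI (filterI eA eB) (filterI eAB ae))).
by move=> x [[-> ->] [-> ->]].
Qed.

(* [T j] is the event that the conditional probability of [A] given [A `|` A1]
   exceeds [j / m.+1], written so that no division by zero can occur. *)
Lemma conditional_levels A A1 (m : nat) : cond_indep P G H F -> G A -> G A1 ->
  A `&` A1 = set0 ->
  exists T : 'I_m.+1 -> set Omega, (forall j, F (T j)) /\
   forall B, H B ->
    `|m.+1%:R^-1 * \sum_j pr P ((A `|` A1) `&` (B `&` T j)) - pr P (A `&` B)|
       <= 2 / m.+1%:R.
Proof.
move=> ci GA GA1 AA1.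
have mA := Gm GA; have mA1 := Gm GA1.
have [p [pv pE]] := cond_indep_causal ci GA.
have [q [qv qE]] := cond_indep_causal ci GA1.
have bp := version_bounded Fm pv; have bq := version_bounded Fm qv.
have [Fp p01 _] := pv; have [Fq q01 _] := qv.
pose s x := p x + q x.
pose T (j : 'I_m.+1) := [set x | j%:R * s x < m.+1%:R * p x].
have FT j : F (T j).
  have /(F_funP sF) h : measurable_fun setT
      ((fun x => m.+1%:R * p x - j%:R * (p x + q x)) : g_sigma_algebraType F -> R).
    move/(F_funP sF) : Fp => Fp; move/(F_funP sF) : Fq => Fq.
    by apply: measurable_funB; apply: measurable_funM => //; exact: measurable_funD.
  have := h `]0, +oo[%classic (measurable_itv _).
  by congr F; rewrite predeqE => x; rewrite /= in_itv/= andbT subr_gt0.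
exists T; split => // B HB.
have mB := Hm HB; have mT j := Fm (FT j).
have bI (C : set Omega) : measurable C -> bounded_mfun (\1_C : _ -> R) by exact: bounded_mfun_indic.
have E1 j : pr P ((A `|` A1) `&` (B `&` T j)) =
    Ex P (fun x => s x * \1_(B `&` T j) x).
  have HBT : H (B `&` T j) by apply: (salgI sH) => //; exact: FH.
  have mBT := Hm HBT.
  rewrite setIUl prU; last 3 first.
  - exact: measurableI.
  - exact: measurableI.
  - by rewrite setIACA AA1 set0I.
  rewrite -pE// -qE// -ExD; [|exact/bounded_mfunM/bI|exact/bounded_mfunM/bI].
  by congr Ex; apply/funext => x; rewrite mulrDl.
under eq_bigr do rewrite E1.
have bs : bounded_mfun s by exact: bounded_mfunD.
have bF (j : 'I_m.+1) : bounded_mfun (fun x => s x * \1_(B `&` T j) x).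
  by apply: bounded_mfunM => //; apply/bI/measurableI.
rewrite -Ex_sum// -ExZ; last exact: bounded_mfun_sum.
rewrite -pE//; apply: Ex_dist; [exact/bounded_mfunZ/bounded_mfun_sum|
  by apply: bounded_mfunM => //; exact: bI|move=> x].
have m0 : (0 : R) < m.+1%:R by rewrite ltr0n.
have c0 : 0 <= 2 / m.+1%:R :> R by rewrite divr_ge0 ?ltW.
rewrite (eq_bigr (fun j : 'I_m.+1 => \1_B x * (s x * \1_(T j) x))); last first.
  by move=> j _; rewrite -indicM; ring.
rewrite -mulr_sumr -mulr_sumr.
rewrite indicE; case: (x \in B) => /=; last by rewrite mul0r !mulr0 subr0 normr0.
rewrite mul1r mulr1.
have /andP[p0 p1] := p01 x; have /andP[q0 q1] := q01 x.
(* If [s] vanishes so does [p], both being nonnegative, and both sides are 0; otherwise the quotient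
   [p / s] is available. *)
have [s0|s0] := eqVneq (s x) 0.
  have -> : p x = 0 by move: s0; rewrite /s; lra.
  by rewrite s0 mul0r mulr0 subr0 normr0.
have sp : 0 < s x by rewrite lt_neqAle eq_sym s0 /s addr_ge0.
have r01 : 0 <= p x / s x <= 1.
  by rewrite divr_ge0 ?(ltW sp)//= ler_pdivrMr// mul1r /s lerDl.
have := layer_cake m r01.
rewrite (eq_bigr (fun j : 'I_m.+1 => \1_(T j) x)); last first.
  move=> j _; rewrite indicE; congr ((nat_of_bool _)%:R).
  by rewrite mulrA ltr_pdivlMr//; apply/idP/idP; rewrite inE.
move: (\sum_j _) => S /andP[S1 S2].
have i0 : 0 < (m.+1%:R : R)^-1 by rewrite invr_gt0.
have S3 : p x <= m.+1%:R^-1 * (s x * S).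
  by move: S1; rewrite ler_pdivrMr// => /le_trans; apply; rewrite mulrA mulrAC.
have S4 : m.+1%:R^-1 * (s x * S) <= p x + s x / m.+1%:R.
  rewrite mulrCA (le_trans (ler_wpM2l (ltW sp) S2))// mulrDr.
  by rewrite mulrCA divff// mulr1.
(* Pointwise [s] is only known to be at most 2, as a sum of two separately chosen versions; hence
   the numerator 2. *)
rewrite ger0_norm ?subr_ge0// lerBlDl (le_trans S4)// lerD2l ler_pM2r//.
by rewrite /s (_ : 2 = 1 + 1 :> R) ?lerD.
Qed.

End Causal.

(** * Simulating adapted events *)

Section Atom.
Context (Omega : Type).
Implicit Types (A : nat -> set Omega) (b : nat -> bool).

Definition atom A b (L : nat) : set Omega :=
  [set w | forall l, (l < L)%N -> b l = `[< A l w >]].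

Lemma atom0 A b : atom A b 0 = setT.
Proof. by rewrite predeqE => w; split. Qed.

Lemma atomS A b L : atom A b L.+1 = atom A b L `&` (if b L then A L else ~` A L).
Proof.
rewrite predeqE => w; split => [Aw|[Aw AL] l].
  split; first by move=> l lL; apply: Aw; exact: ltnW.
  by have := Aw L (leqnn _); case: (b L) => /esym; [move/asboolP|move/asboolPn].
rewrite ltnS leq_eqVlt => /predU1P[->|]; last exact: Aw.
by case: (b L) AL => AL; apply/esym; [exact/asboolP|exact/asboolPn].
Qed.

Lemma eq_atom A A' b b' L : (forall l, (l < L)%N -> A l = A' l) ->
  (forall l, (l < L)%N -> b l = b' l) -> atom A b L = atom A' b' L.
Proof.
by move=> AA bb; rewrite predeqE => w; split => Aw l lL;
  [rewrite -bb// -AA//|rewrite bb// AA//]; exact: Aw.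
Qed.

Lemma atom_salg (F : set (set Omega)) A b L : sigma_algebra setT F ->
  (forall l, (l < L)%N -> F (A l)) -> F (atom A b L).
Proof.
move=> sF; elim: L => [|L IH] FA; first by rewrite atom0; exact: salgT.
rewrite atomS; apply: (salgI sF); first by apply: IH => l lL; apply: FA; exact: ltnW.
by case: (b L); [exact: FA|apply: (salgC sF); exact: FA].
Qed.

(** A finite pattern extended by [false], so that [atom] can take infinite sequences while sums run
    over a finite type. *)
Definition pattern (L : nat) (f : {ffun 'I_L -> bool}) (l : nat) : bool :=
  if insub l is Some i then f i else false.

Lemma patternE L (f : {ffun 'I_L -> bool}) (i : 'I_L) : pattern f i = f i.
Proof. by rewrite /pattern valK. Qed.

Lemma pattern_finfun L b l : (l < L)%N -> pattern [ffun i : 'I_L => b i] l = b l.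
Proof. by move=> lL; rewrite (patternE _ (Ordinal lL)) ffunE. Qed.

Lemma atom_inj L (f g : {ffun 'I_L -> bool}) A w :
  atom A (pattern f) L w -> atom A (pattern g) L w -> f = g.
Proof.
move=> fw gw; apply/ffunP => i.
by rewrite -!patternE fw// gw.
Qed.

End Atom.

Section Approximation.
Context (d : measure_display) (Omega : measurableType d) (R : realType).
Variable P : probability Omega R.
Variables (F G : nat -> set (set Omega)) (H : set (set Omega)).
Hypotheses (sF : forall l, sigma_algebra setT (F l)) (sG : forall l, sigma_algebra setT (G l))
  (sH : sigma_algebra setT H).
Hypotheses (Gm : forall l, G l `<=` measurable) (Hm : H `<=` measurable).
Hypotheses (FH : forall l, F l `<=` H).
Hypotheses (FF : forall k l, (k <= l)%N -> F k `<=` F l)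
  (GG : forall k l, (k <= l)%N -> G k `<=` G l).
Hypothesis ci : forall l, cond_indep P (G l) H (F l).
Context (T : topologicalType) (Y : Omega -> T).
Hypotheses (pT : polish R T) (mY : random_var Y) (nY : nonatomic_law P Y)
  (FY : meas_wrt (F 0) Y).
Variable A : nat -> set Omega.
Hypothesis GA : forall l, G l (A l).

(** Induction on the number of bits, with the test family and the error left free: simulating bit
    [L] requires the earlier bits to be accurate on a larger family and with a smaller error. *)
Lemma adapted_approximation (L : nat) (J : finType) (B : J -> set Omega) (e : R) :
  (forall j, H (B j)) -> 0 < e ->
  exists A' : nat -> set Omega, (forall l, (l < L)%N -> F l (A' l)) /\
    forall b j, `|pr P (atom A' b L `&` B j) - pr P (atom A b L `&` B j)| <= e.
Proof.
have Fm l : F l `<=` measurable by move=> C /FH /Hm.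
elim: L J B e => [|L IH] J B e HB e0.
  by exists A; split => // b j; rewrite !atom0 subrr normr0 ltW.
(* Three quarters are spent in [key], where bit [L] is on; if it is off, the event is a difference
   and the induction hypothesis costs the fourth. *)
have e40 : 0 < e / 4 by rewrite divr_gt0.
pose m := Num.trunc (2 / (e / 4)).
have m0 : (0 : R) < m.+1%:R by rewrite ltr0n.
have me : 2 / m.+1%:R <= e / 4.
  rewrite ler_pdivrMr// mulrC -ler_pdivrMr//; apply/ltW; exact: truncnS_gt.
have GA0 b l k : (l <= k)%N -> G k (atom A b l).
  by move=> lk; apply: atom_salg => // i il; apply: (GG _ (GA i)); exact: leq_trans (ltnW il) lk.
pose PT := {ffun 'I_L -> bool}.
have lev (f : PT) : exists Tf : 'I_m.+1 -> set Omega, (forall j, F L (Tf j)) /\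
   forall C, H C ->
    `|m.+1%:R^-1 * \sum_j pr P (atom A (pattern f) L `&` (C `&` Tf j)) -
       pr P (atom A (pattern f) L `&` A L `&` C)| <= 2 / m.+1%:R.
  have [|||Tf [FTf TfE]] := conditional_levels (sF L) (@Fm L) (@Gm L) sH Hm (@FH L)
    (A := atom A (pattern f) L `&` A L) (A1 := atom A (pattern f) L `&` ~` A L) m (@ci L).
  - by apply: (salgI (sG L)) => //; exact: GA0.
  - by apply: (salgI (sG L)); [exact: GA0|exact: (salgC (sG L))].
  - by rewrite setIACA setICr setI0.
  by exists Tf; split => // C HC; have := TfE C HC; rewrite -setIUr setUv setIT.
have [Tf TfP] := choice lev.
have FT f j : F L (Tf f j) by case: (TfP f).
have mT f j : measurable (Tf f j) by exact: Fm (FT f j).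
(* The level events [Tf] are computed from the true atoms, so they can be added to the test family
   before the earlier bits are simulated. *)
pose B' (k : J + (J * PT * 'I_m.+1)) := match k with
  | inl j => B j | inr (j, f, i) => B j `&` Tf f i end.
have [|A' [FA' A'E]] := IH _ B' (e / 4) _ e40.
  by move=> [j|[[j f] i]] //=; apply: (salgI sH) => //; exact: FH (FT f i).
have FAt f : F L (atom A' f L).
  by apply: atom_salg => // l lL; apply: (FF (ltnW lL)); exact: FA'.
have mAt f : measurable (atom A' f L) by exact: Fm (FAt f).
have mB j : measurable (B j) by exact: Hm.
pose E (k : J * PT * 'I_m.+1) :=
  atom A' (pattern k.1.2) L `&` (B k.1.1 `&` Tf k.1.2 k.2).
have mE k : measurable (E k) by apply: measurableI => //; exact: measurableI.
have eM : 0 < e / 4 / m.+1%:R by rewrite divr_gt0.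
have FYL : meas_wrt (F L) Y by move=> C oC; apply: (FF (leq0n L)); exact: FY.
(* [V] is chosen after [A'], hence nearly independent of events that involve the simulated bits; the
   same [Y] can therefore serve at every step. *)
have [V [FV tV VE]] := mixing m pT mY nY (sF L) (@Fm L) FYL mE eM.
have mV j : measurable (V j) by exact: Fm (FV j).
(* On the simulated atom of pattern [f], the new bit is on when [V] takes a value [i] whose level
   event [Tf f i] holds, that is, when [i / m.+1] is below the conditional probability of the
   bit. *)
pose D := \big[setU/set0]_f \big[setU/set0]_i
  (atom A' (pattern f) L `&` (Tf f i `&` V i)).
have FD : F L D.
  apply: salg_bigU => // f _; apply: salg_bigU => // i _.
  by apply: (salgI (sF L)) => //; exact: (salgI (sF L)).
have mD : measurable D by exact: Fm FD.
pose A2 l := if l == L then D else A' l.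
have A2E b : atom A2 b L = atom A' b L.
  by apply: eq_atom => // l lL; rewrite /A2 ltn_eqF.
have A2L : A2 L = D by rewrite /A2 eqxx.
have key b j : `|pr P (atom A' b L `&` D `&` B j) - pr P (atom A b L `&` A L `&` B j)|
    <= 3 * (e / 4).
  pose f : PT := [ffun i : 'I_L => b i].
  have fb l : (l < L)%N -> b l = pattern f l by move=> lL; rewrite pattern_finfun.
  rewrite (eq_atom (A := A') (A' := A') _ fb)// (eq_atom (A := A) (A' := A) _ fb)//.
  have -> : atom A' (pattern f) L `&` D `&` B j =
      \big[setU/set0]_i (E (j, f, i) `&` V i).
    rewrite predeqE => w; split.
      move=> [[fw /bigsetUP[g [_ /bigsetUP[i [_ [gw [Tw Vw]]]]]] Bw]].
      move: Tw; rewrite -(atom_inj fw gw) => Tw.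
      by apply/bigsetUP; exists i.
    move=> /bigsetUP[i [_ [[fw [Bw Tw]] Vw]]]; split => //; split => //.
    by apply/bigsetUP; exists f; split => //; apply/bigsetUP; exists i.
  rewrite pr_bigU; last 2 first.
  - by move=> i; exact: measurableI.
  - by move=> i k w [_ Vi] [_ Vk]; exact: tV Vi Vk.
  (* Three replacements of cost [e / 4]: [S1] treats [V] as uniform and independent, [S2] puts the
     true atom for the simulated one, and averaging over the levels in [S2] recovers [A L]. *)
  pose S1 : R := \sum_i pr P (E (j, f, i)) / m.+1%:R.
  pose S2 : R := \sum_i pr P (atom A (pattern f) L `&` (B j `&` Tf f i)) / m.+1%:R.
  have d1 : `|\sum_i pr P (E (j, f, i) `&` V i) - S1| <= e / 4.
    rewrite /S1 -sumrB; apply: (le_trans (ler_norm_sum _ _ _)).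
    apply: (@le_trans _ _ (\sum_(i < m.+1) e / 4 / m.+1%:R)).
      by apply: ler_sum => i _; apply/ltW; exact: VE.
    by rewrite sumr_const card_ord -[_ *+ _]mulr_natr divfK// gt_eqF.
  have d2 : `|S1 - S2| <= e / 4.
    rewrite /S1 /S2 -sumrB; apply: (le_trans (ler_norm_sum _ _ _)).
    apply: (@le_trans _ _ (\sum_(i < m.+1) e / 4 / m.+1%:R)).
      apply: ler_sum => i _; rewrite -mulrBl normrM [`|_^-1|]ger0_norm ?invr_ge0 ?(ltW m0)//.
      by rewrite ler_pM2r ?invr_gt0//; exact: (A'E (pattern f) (inr (j, f, i))).
    by rewrite sumr_const card_ord -[_ *+ _]mulr_natr divfK// gt_eqF.
  have d3 : `|S2 - pr P (atom A (pattern f) L `&` A L `&` B j)| <= e / 4.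
    apply: (le_trans _ me); have [_ /(_ (B j) (HB j))] := TfP f.
    by rewrite /S2 -mulr_suml mulrC.
  move: d1 d2 d3; set x := \sum_i _; set y := pr P _ => d1 d2 d3.
  rewrite (_ : x - y = (x - S1) + (S1 - S2) + (S2 - y)); last by ring.
  apply: (le_trans (ler_normD _ _)).
  rewrite (_ : 3 * (e / 4) = e / 4 + e / 4 + e / 4); last by ring.
  by apply: lerD => //; apply: (le_trans (ler_normD _ _)); exact: lerD.
exists A2; split.
  move=> l; rewrite ltnS leq_eqVlt /A2 => /predU1P[->|lL]; first by rewrite eqxx.
  by rewrite ltn_eqF//; exact: FA'.
move=> b j; rewrite !atomS A2E A2L.
have kbj := key b j.
case: (b L).
  by apply: (le_trans kbj); lra.
have mAb : measurable (atom A b L) by apply: (@Gm L); exact: GA0.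
have mAL : measurable (A L) by exact: (@Gm L).
have s1 : pr P (atom A' b L `&` ~` D `&` B j) =
    pr P (atom A' b L `&` B j) - pr P (atom A' b L `&` D `&` B j).
  have mAB : measurable (atom A' b L `&` B j) by exact: measurableI.
  by rewrite (pr_split P mAB mD) [X in pr P X + _]setIAC [X in _ + pr P X]setIAC addrAC subrr add0r.
have s2 : pr P (atom A b L `&` ~` A L `&` B j) =
    pr P (atom A b L `&` B j) - pr P (atom A b L `&` A L `&` B j).
  have mAB : measurable (atom A b L `&` B j) by exact: measurableI.
  rewrite (pr_split P mAB mAL) [X in pr P X + _]setIAC [X in _ + pr P X]setIAC.
  by rewrite addrAC subrr add0r.
rewrite s1 s2; have := A'E b (inl j) => /=.
move: kbj; set x1 := pr P _; set x2 := pr P _; set x3 := pr P _; set x4 := pr P _.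
rewrite !ler_norml => /andP[h1 h2] /andP[h3 h4].
by apply/andP; split; lra.
Qed.

End Approximation.

(** * Boxes and joint measurability in product spaces *)

Lemma ptws_polish_box (R : realType) (I : finType) (T : topologicalType)
    (v : nat -> T -> R) :
  (forall (G : set T) x, open G -> G x ->
      exists i, 0 < v i x /\ forall y, 0 < v i y -> G y) ->
  forall (x : {ptws I -> T}) (G : set {ptws I -> T}), nbhs x G ->
  exists k : {ffun I -> nat}, (forall i, 0 < v (k i) (x i)) /\
    forall y : {ptws I -> T}, (forall i, 0 < v (k i) (y i)) -> G y.
Proof.
move=> vB x G /ptws_nbhs_box[B [oB Bx BG]].
have [k kP] := choice (fun i => vB (B i) (x i) (oB i) (Bx i)).
exists [ffun i => k i]; split => [i|y ky]; first by rewrite ffunE; case: (kP i).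
by apply: BG => i; have := ky i; rewrite ffunE; case: (kP i) => _; apply.
Qed.

Lemma prod_ptws_box (R : realType) (I : finType) (S T : topologicalType)
    (u : nat -> S -> R) (v : nat -> T -> R) :
  (forall (G : set S) x, open G -> G x ->
      exists i, 0 < u i x /\ forall y, 0 < u i y -> G y) ->
  (forall (G : set T) x, open G -> G x ->
      exists i, 0 < v i x /\ forall y, 0 < v i y -> G y) ->
  forall (G : set (S * {ptws I -> T})%type) p, open G -> G p ->
  exists k : nat * {ffun I -> nat},
    (0 < u k.1 p.1 /\ forall i, 0 < v (k.2 i) (p.2 i)) /\
    forall q, (0 < u k.1 q.1 /\ forall i, 0 < v (k.2 i) (q.2 i)) -> G q.
Proof.
move=> uB vB G p oG Gp.
have [[C D] /= [nC nD] CDG] : nbhs p G by exact: open_nbhs_nbhs.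
move: nC; rewrite nbhsE => -[C' [oC' C'p] C'C].
have [k1 [uk1 k1C]] := uB C' p.1 oC' C'p.
have [k2 [vk2 k2D]] := ptws_polish_box vB nD.
exists (k1, k2); split => // q /= [q1 q2]; apply: CDG; split => /=.
  exact/C'C/k1C.
exact: k2D.
Qed.

(** Boxes of base sets are indexed by a countable type, so an open set of the product is a countable
    union of boxes and coordinatewise measurability is enough. *)
Lemma ptws_meas_wrt (R : realType) (Omega : Type) (I : finType)
    (T : topologicalType) (X : I -> Omega -> T) (F : set (set Omega)) :
  polish R T -> sigma_algebra setT F -> (forall i, meas_wrt F (X i)) ->
  meas_wrt F ((fun w i => X i w) : Omega -> {ptws I -> T}).
Proof.
move=> pT sF XF G oG; have [v [cv vB]] := polish_base pT.
pose box (k : {ffun I -> nat}) := [set y : {ptws I -> T} | forall i, 0 < v (k i) (y i)].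
rewrite (_ : _ @^-1` G = \bigcup_(k in [set k | box k `<=` G])
    [set w | forall i, (X i @^-1` [set y | 0 < v (k i) y]) w]).
  apply: (salg_bigcup sF) => k _; apply: (salg_bigcap sF) => i; apply: XF.
  exact: continuous_open_pos.
rewrite predeqE => w; split => /= [Gw|[k kG kw]]; last exact: kG.
have [k [kw kG]] := ptws_polish_box vB (open_nbhs_nbhs (conj oG Gw)).
by exists k.
Qed.

Lemma prod_ptws_meas (R : realType) (Omega : Type) (I : finType)
    (S T : topologicalType) (Z : Omega -> S) (X : I -> Omega -> T) (F : set (set Omega)) :
  polish R S -> polish R T -> sigma_algebra setT F -> meas_wrt F Z ->
  (forall i, meas_wrt F (X i)) ->
  meas_wrt F ((fun w => (Z w, fun i => X i w)) : Omega -> (S * {ptws I -> T})%type).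
Proof.
move=> pS pT sF ZF XF G oG.
have [u [cu uB]] := polish_base pS; have [v [cv vB]] := polish_base pT.
pose box (k : nat * {ffun I -> nat}) := [set q : S * {ptws I -> T} |
  0 < u k.1 q.1 /\ forall i, 0 < v (k.2 i) (q.2 i)].
rewrite (_ : _ @^-1` G = \bigcup_(k in [set k | box k `<=` G])
    (Z @^-1` [set y | 0 < u k.1 y] `&`
     [set w | forall i, (X i @^-1` [set y | 0 < v (k.2 i) y]) w])).
  apply: (salg_bigcup sF) => k _; apply: (salgI sF).
    by apply: ZF; exact: continuous_open_pos.
  apply: (salg_bigcap sF) => i; apply: XF; exact: continuous_open_pos.
rewrite predeqE => w; split => /= [Gw|[k kG [kz kw]]]; last exact: kG.
have [k [kw kG]] := prod_ptws_box uB vB oG Gw.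
by exists k.
Qed.

Lemma simple_variable_approximation d (Omega : measurableType d) (R : realType)
    (P : probability Omega R) (I : finType) (T S : topologicalType)
    (Y : I -> Omega -> T) (r : nat) (C : nat -> set Omega) (x : seq bool -> S) (e : R) :
  polish R T -> homeo_convex_lcs R S -> (forall i, random_var (Y i)) ->
  (forall t, (t < r)%N -> sigma_gen Y setT (C t)) -> 0 < e ->
  exists fE : ({ptws I -> T} -> S) * set Omega,
    [/\ continuous fE.1, measurable fE.2, pr P fE.2 <= e &
    forall w, ~ fE.2 w ->
      fE.1 (fun i => Y i w) = x (mkseq (fun t => `[< C t w >]) r)].
Proof.
move=> pT /convex_combination[cc [cc0 cc1 ccc]] mY FC e0.
have er0 : 0 < e / r.+1%:R by rewrite divr_gt0 ?ltr0n.
have lus t : exists uE : ({ptws I -> T} -> R) * set Omega,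
    [/\ continuous uE.1, forall y, 0 <= uE.1 y <= 1, measurable uE.2,
    pr P uE.2 <= e / r.+1%:R & (t < r)%N -> forall w, ~ uE.2 w ->
      uE.1 (fun i => Y i w) = \1_(C t) w].
  have [tr|tr] := ltnP t r; last first.
    (* A dummy for bits beyond [r]: [decision_tree] takes an infinite sequence of functions with
       values in [[0, 1]]. *)
    exists (fun=> 0, set0); split => //=; first exact: cst_continuous.
      by rewrite lexx ler01.
    by rewrite pr0 ltW.
  have [_ /(_ _ er0)[u [cu u01 [E [mE Ee uE]]]]] := lusin_sigma_gen P pT mY (FC t tr).
  by exists (u, E); split => //=; exact: ltW.
have [uE uEP] := choice lus.
have [||f [cf fE]] := decision_tree cc0 cc1 ccc r x (u := fun t => (uE t).1).
- by move=> t; case: (uEP t).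
- by move=> t; case: (uEP t).
exists (f, \big[setU/set0]_(t < r) (uE t).2); split => //=.
- by apply: bigsetU_measurable => t _; case: (uEP t).
- apply: (le_trans (pr_le_bigU _ _ _ _)) => [t|]; first by case: (uEP t).
  apply: (@le_trans _ _ (\sum_(t < r) e / r.+1%:R)).
    by apply: ler_sum => t _; case: (uEP t).
  rewrite sumr_const card_ord -[_ *+ _]mulr_natr -mulrA ler_piMr ?(ltW e0)//.
  by rewrite ler_pdivrMl ?ltr0n// mulr1 ler_nat.
- move=> w nE; apply: fE => t tr; have [_ _ _ _ /(_ tr) ->] := uEP t.
    by rewrite indicE; congr ((nat_of_bool _)%:R); apply/idP/asboolP; rewrite inE.
  by move=> Et; apply: nE; apply/bigsetUP; exists (Ordinal tr).
Qed.

Definition path_upto (Omega : Type) (T : topologicalType) (N : nat)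
    (Y : 'I_N -> Omega -> T) (n : 'I_N) (w : Omega) : {ptws 'I_n.+1 -> T} :=
  fun i => Y (widen_ord (ltn_ord n) i) w.
Arguments path_upto {Omega T N} Y n w.

(** * Continuous adapted simulation tested on finitely many boxes *)

Section BoxApproximation.
Context (d : measure_display) (Omega : measurableType d) (R : realType).
Variable P : probability Omega R.
Context (Zs Ys Xs : topologicalType) (N : nat) (hN : (0 < N)%N).
Variables (Z : Omega -> Zs) (Y : 'I_N -> Omega -> Ys) (X : 'I_N -> Omega -> Xs).
Hypotheses (pY : polish R Ys) (cX : homeo_convex_lcs R Xs).
Hypotheses (mZ : random_var Z) (mY : forall n, random_var (Y n))
  (mX : forall n, random_var (X n)) (nY : nonatomic_law P (Y (Ordinal hN)))
  (ZY : forall n, meas_wrt (sigma_rv Z) (Y n)).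

Let FY (n : 'I_N) := sigma_gen Y [set i : 'I_N | (i <= n)%N].
Let FX (n : 'I_N) := sigma_gen X [set i : 'I_N | (i <= n)%N].

Hypothesis ci : forall n, cond_indep P (FX n) (sigma_rv Z) (FY n).

(** Reindexing by ['I_n.+1] makes the Lusin functions depend on the first [n.+1] coordinates alone,
    as condition (iii) demands. *)
Lemma sigma_gen_upto (n : 'I_N) :
  FY n `<=` sigma_gen (fun i : 'I_n.+1 => Y (widen_ord (ltn_ord n) i)) setT.
Proof.
apply: sigma_gen_min; first exact: sigma_gen_alg.
move=> i /= iln C oC.
have -> : Y i = Y (widen_ord (ltn_ord n) (Ordinal (iln : (i < n.+1)%N))).
  by congr Y; exact: val_inj.
exact: (@sigma_gen_open _ _ _ (fun i : 'I_n.+1 => Y (widen_ord (ltn_ord n) i))).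
Qed.

Lemma continuous_path_meas (n : 'I_N) (f : {ptws 'I_n.+1 -> Ys} -> Xs) :
  continuous f -> meas_wrt (FY n) (fun w => f (path_upto Y n w)).
Proof.
move=> cf C oC.
have oD : open (f @^-1` C) by apply: open_comp oC => x _; exact: cf.
have := @ptws_meas_wrt R Omega _ _ (fun i : 'I_n.+1 => Y (widen_ord (ltn_ord n) i)) (FY n)
  pY (@sigma_gen_alg _ _ _ _ _) _ _ oD.
apply => i B oB; apply: sigma_gen_open => //=.
by rewrite -ltnS.
Qed.

Definition in_boxes (r : nat) (W : nat -> set Zs) (U : nat -> 'I_N -> set Xs)
    (S : {set 'I_r}) (X' : 'I_N -> Omega -> Xs) : set Omega :=
  [set w | exists t : 'I_r, [/\ t \in S, W t (Z w) & forall n, U t n (X' n w)]].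

Lemma in_boxes_measurable r W U S X' : (forall t, open (W t)) ->
  (forall t n, open (U t n)) -> (forall n, random_var (X' n)) ->
  measurable (@in_boxes r W U S X').
Proof.
move=> oW oU mX'; rewrite (_ : in_boxes _ _ _ _ = \bigcup_(t in [set t : 'I_r | t \in S])
   (Z @^-1` W t `&` [set w | forall n, (X' n @^-1` U t n) w])).
  have sm := @sigma_algebra_measurable _ Omega.
  apply: (salg_bigcup sm) => t _; apply: (salgI sm); first exact: mZ.
  by apply: (salg_bigcap sm) => n; exact: mX'.
by rewrite predeqE => w; split=> [[t [tS Wt Ut]]|[t tS [Wt Ut]]]; exists t.
Qed.

(** The bits record whether [X n] lies in [U t n]. One [f] serves all subfamilies [S] at once, which
    later lets a single sequence handle every open set. Only an inequality can hold: simulated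
    values respect the bits that are on and may enter other boxes. *)
Lemma box_approximation (r : nat) (W : nat -> set Zs) (U : nat -> 'I_N -> set Xs)
    (e : R) : (forall t, open (W t)) -> (forall t n, open (U t n)) -> 0 < e ->
  exists f : forall n : 'I_N, {ptws 'I_n.+1 -> Ys} -> Xs,
    (forall n, continuous (f n)) /\
    forall S : {set 'I_r}, pr P (in_boxes W U S X) <=
      pr P (in_boxes W U S (fun n w => f n (path_upto Y n w))) + e.
Proof.
move=> oW oU e0.
pose L := (N * r)%N.
(* Bit [n * r + t] concerns time [n] and box [t]; the minimum only keeps [lev] in range for bits
   beyond [L]. *)
have ltN l : (minn (l %/ r) N.-1 < N)%N.
  by rewrite (leq_ltn_trans (geq_minr _ _))// prednK.
pose lev l : 'I_N := Ordinal (ltN l).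
have lev_mono k l : (k <= l)%N -> (lev k <= lev l)%N.
  by move=> kl; rewrite leq_min geq_minr andbT geq_min leq_div2r.
have levE (n : 'I_N) (t : 'I_r) : lev (n * r + t)%N = n.
  apply: val_inj => /=; rewrite divnMDl ?divn_small ?addn0//.
    by apply/minn_idPl; rewrite -ltnS prednK.
  by apply: leq_ltn_trans (ltn_ord t).
have modE (n : 'I_N) (t : 'I_r) : ((n * r + t) %% r)%N = t.
  by rewrite modnMDl modn_small.
have ltL (n : 'I_N) (t : 'I_r) : (n * r + t < L)%N.
  by apply: (@leq_trans (n.+1 * r)%N);
    [rewrite mulSn addnC ltn_add2r|rewrite leq_mul2r ltn_ord orbT].
pose A l := X (lev l) @^-1` U (l %% r)%N (lev l).
have AE (n : 'I_N) (t : 'I_r) : A (n * r + t)%N = X n @^-1` U t n.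
  by rewrite /A levE modE.
have mono (T : topologicalType) (V : 'I_N -> Omega -> T) k l : (k <= l)%N ->
    sigma_gen V [set i : 'I_N | (i <= lev k)%N] `<=` sigma_gen V [set i : 'I_N | (i <= lev l)%N].
  move=> kl; apply: sigma_gen_min; first exact: sigma_gen_alg.
  move=> i /= ik C oC; apply: sigma_gen_open => //=.
  exact: leq_trans (lev_mono _ _ kl).
have Hm : sigma_rv Z `<=` measurable by apply: sigma_gen_measurable => _; exact: mZ.
have FH n : FY n `<=` sigma_rv Z.
  by apply: sigma_gen_min => [|i _]; [exact: sigma_gen_alg|exact: ZY].
have FYm n : FY n `<=` measurable by exact: sigma_gen_measurable.
have FXm n : FX n `<=` measurable by exact: sigma_gen_measurable.
have GA l : FX (lev l) (A l) by apply: sigma_gen_open => //=.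
have F0 : meas_wrt (FY (lev 0)) (Y (Ordinal hN)).
  by move=> C oC; apply: sigma_gen_open.
pose PT := {ffun 'I_L -> bool}.
(* Once the pattern of [X] is fixed, membership in the selected boxes is a condition on [Z] alone,
   hence an admissible test event. *)
pose B (k : {set 'I_r} * PT) := \bigcup_(t in [set t : 'I_r | t \in k.1 /\
   forall n : 'I_N, pattern k.2 (n * r + t)%N]) Z @^-1` W t.
have HB k : sigma_rv Z (B k).
  apply: salg_bigcup; first exact: sigma_gen_alg.
  by move=> t _; exact: (@sigma_gen_open _ _ _ (fun _ : unit => Z) setT tt).
have e20 : 0 < e / 2 by rewrite divr_gt0.
have c0 : (0 : R) < #|PT|.+1%:R by rewrite ltr0n.
(* Half of [e] is spread over the patterns, the other half over the exceptional events of the [N]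
   times. *)
have eP : 0 < e / 2 / #|PT|.+1%:R by rewrite divr_gt0.
have FXl l : FX (lev l) `<=` measurable by exact: FXm.
have FHl l : FY (lev l) `<=` sigma_rv Z by exact: FH.
have [A' [FA' A'E]] := adapted_approximation (fun l => sigma_gen_alg Y _)
  (fun l => sigma_gen_alg X _) (sigma_gen_alg _ _) FXl Hm FHl
  (mono _ Y) (mono _ X) (fun l => @ci (lev l)) pY (mY _) nY F0 GA L HB eP.
have FA2 (n : 'I_N) t : (t < r)%N -> FY n (A' (n * r + t)%N).
  by move=> tr; have := FA' _ (ltL n (Ordinal tr)); rewrite levE.
(* The value assigned to the bits at time [n]: a common point of the sets whose bits are on, or a
   default when there is none. *)
have rep (n : 'I_N) (c : seq bool) : exists x : Xs,
    (exists y, forall t, (t < r)%N -> nth false c t -> U t n y) ->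
    forall t, (t < r)%N -> nth false c t -> U t n x.
  have [[y yU]|nU] := pselect (exists y, forall t, (t < r)%N -> nth false c t -> U t n y).
    by exists y.
  by exists (X n point).
pose x n c := sval (cid (rep n c)).
have xP n c := svalP (cid (rep n c)).
have eN : 0 < e / 2 / N.+1%:R by rewrite divr_gt0 ?ltr0n.
have ex (n : 'I_N) := @simple_variable_approximation _ Omega R P _ Ys Xs
  (fun i : 'I_n.+1 => Y (widen_ord (ltn_ord n) i)) r (fun t => A' (n * r + t)%N)
  (x n) (e / 2 / N.+1%:R) pY cX (fun i => mY _)
  (fun t tr => @sigma_gen_upto n _ (FA2 n t tr)) eN.
pose fE n := sval (cid (ex n)).
have fEP n := svalP (cid (ex n)).
exists (fun n => (fE n).1); split; first by move=> n; case: (fEP n).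
move=> S.
pose E := \big[setU/set0]_n (fE n).2.
have mE : measurable E by apply: bigsetU_measurable => n _; case: (fEP n).
have Ee : pr P E <= e / 2.
  apply: (le_trans (pr_le_bigU _ _ _ _)) => [n|]; first by case: (fEP n).
  apply: (@le_trans _ _ (\sum_(n < N) e / 2 / N.+1%:R)).
    by apply: ler_sum => n _; case: (fEP n).
  rewrite sumr_const card_ord -[_ *+ _]mulr_natr -mulrA ler_piMr ?(ltW e20)//.
  by rewrite ler_pdivrMl ?ltr0n// mulr1 ler_nat.
(* Simulated bits may form a pattern that [X] never shows. Patterns in [Q] have a witness [w0], and
   [X n w0] is then the common point that [rep] needs. *)
pose Q (f : PT) := `[< exists w, atom A (pattern f) L w >].
have mAt f : measurable (atom A (pattern f) L).
  apply: (@atom_salg _ measurable); first exact: sigma_algebra_measurable.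
  by move=> l _; exact: FXl (GA l).
have mAt' f : measurable (atom A' (pattern f) L).
  apply: (@atom_salg _ measurable); first exact: sigma_algebra_measurable.
  by move=> l lL; exact: FYm (FA' l lL).
have mB k : measurable (B k) by exact: Hm.
have mX' n : random_var (fun w => (fE n).1 (path_upto Y n w)).
  move=> C oC; apply: (FYm n); apply: continuous_path_meas oC.
  by case: (fEP n).
have sub : in_boxes W U S X `<=`
    \big[setU/set0]_(f | Q f) (atom A (pattern f) L `&` B (S, f)).
  move=> w [t [tS Wt Ut]]; pose f : PT := [ffun i : 'I_L => `[< A i w >]].
  have fw : atom A (pattern f) L w by move=> l lL; rewrite (pattern_finfun (fun i => `[< A i w >])).
  apply/bigsetUP; exists f; split; first by apply/asboolP; exists w.
  split=> //; exists t => //=; split => // n.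
  by rewrite (pattern_finfun (fun i => `[< A i w >]))// AE; apply/asboolP; exact: Ut.
have sub' : \big[setU/set0]_(f | Q f) (atom A' (pattern f) L `&` B (S, f)) `<=`
    in_boxes W U S (fun n w => (fE n).1 (path_upto Y n w)) `|` E.
  move=> w /bigsetUP[f [/asboolP[w0 fw0] [fw [t [tS ft] Wt]]]].
  have [Ew|nEw] := pselect (E w); [by right|left].
  exists t; split => // n.
  have [_ _ _ ->] := fEP n; last by move=> En; apply: nEw; apply/bigsetUP; exists n.
  apply: (xP n) => //.
    exists (X n w0) => s sr; rewrite nth_mkseq// -(fw _ (ltL n (Ordinal sr))).
    by rewrite (fw0 _ (ltL n (Ordinal sr))) (AE n (Ordinal sr)) => /asboolP.
  by rewrite nth_mkseq// -(fw _ (ltL n t)).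
have mIB X0 : (forall n, random_var (X0 n)) -> measurable (in_boxes W U S X0).
  exact: in_boxes_measurable.
have mbig (A0 : nat -> set Omega) : (forall f : PT, measurable (atom A0 (pattern f) L)) ->
    forall f : PT, measurable (atom A0 (pattern f) L `&` B (S, f)).
  by move=> m0 f; exact: measurableI.
have disj (A0 : nat -> set Omega) (f g : PT) w :
    (atom A0 (pattern f) L `&` B (S, f)) w -> (atom A0 (pattern g) L `&` B (S, g)) w -> f = g.
  by move=> [fw _] [gw _]; exact: atom_inj fw gw.
apply: (@le_trans _ _ (\sum_(f | Q f) pr P (atom A (pattern f) L `&` B (S, f)))).
  rewrite -pr_bigU; [|exact: mbig|exact: disj].
  apply: le_pr => //; first exact: mIB.
  by apply: bigsetU_measurable => f _; exact: mbig.
apply: (@le_trans _ _ (\sum_(f | Q f) (pr P (atom A' (pattern f) L `&` B (S, f))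
    + e / 2 / #|PT|.+1%:R))).
  apply: ler_sum => f _; have := A'E (pattern f) (S, f).
  by rewrite ler_norml lerBrDl => /andP[h _]; rewrite -lerBlDr.
rewrite big_split/= -pr_bigU; [|exact: mbig|exact: disj].
rewrite [X in _ <= _ + X](splitr e) addrA; apply: lerD; last first.
  apply: (@le_trans _ _ (\sum_(f : PT) e / 2 / #|PT|.+1%:R)).
    by rewrite [leRHS](bigID Q)/= lerDl sumr_ge0// => f _; exact: ltW.
  rewrite sumr_const -[_ *+ _]mulr_natr -mulrA ler_piMr ?(ltW e20)//.
  by rewrite ler_pdivrMl// mulr1 ler_nat.
apply: (@le_trans _ _ (pr P (in_boxes W U S
    (fun n w => (fE n).1 (path_upto Y n w)) `|` E))).
  apply: le_pr => //; first by apply: bigsetU_measurable => f _; exact: mbig.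
  by apply: measurableU => //; exact: mIB.
by apply: (le_trans (pr_leU _ _ _)) => //; [exact: mIB|rewrite lerD2l].
Qed.

End BoxApproximation.

(** * Convergence in law *)

Lemma random_var_real d (Omega : measurableType d) (R : realType) (f : Omega -> R) :
  random_var f -> measurable_fun setT f.
Proof.
move=> mf; apply: (measurability _ (RGenOpens.measurableE R)).
move=> _ [_ [a [b ->]] <-]; rewrite setTI; apply: mf; exact: interval_open.
Qed.

Section Portmanteau.
Context (d : measure_display) (Omega : measurableType d) (R : realType).
Variable P : probability Omega R.
Context (Zs Xs : topologicalType) (N : nat).
Hypotheses (pZ : polish R Zs) (pX : polish R Xs).

Let V := (Zs * {ptws 'I_N -> Xs})%type.

Let joint (Z : Omega -> Zs) (X : 'I_N -> Omega -> Xs) (w : Omega) : V :=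
  (Z w, fun i => X i w).

Variables (Z : Omega -> Zs) (X : 'I_N -> Omega -> Xs) (Xk : nat -> 'I_N -> Omega -> Xs).
Hypotheses (mZ : random_var Z) (mX : forall n, random_var (X n))
  (mXk : forall k n, random_var (Xk k n)).

Let mpair X' : (forall n, random_var (X' n)) -> random_var (joint Z X').
Proof.
by move=> mX'; apply: (prod_ptws_meas pZ pX) => //; exact: sigma_algebra_measurable.
Qed.

Lemma bounded_mfun_joint X' (f : V -> R) (M : R) : (forall n, random_var (X' n)) ->
  continuous f -> (forall p, `|f p| <= M) -> bounded_mfun (f \o joint Z X').
Proof.
move=> mX' cf fM; split; last by exists M => w; exact: fM.
apply: random_var_real => C oC; rewrite comp_preimage; apply: (mpair mX').
by apply: open_comp oC => x _; exact: cf.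
Qed.

(** The portmanteau argument: superlevel sets of a continuous function are open, so the layer-cake
    average transfers the one-sided bound from open sets to expectations of continuous functions
    with values in [[0, 1]]. *)
Lemma conv_law_of_open :
  (forall (G : set V) e, open G -> 0 < e -> exists K, forall k, (K <= k)%N ->
     pr P (joint Z X @^-1` G) <= pr P (joint Z (Xk k) @^-1` G) + e) ->
  conv_law P Z Xk X.
Proof.
move=> openE.
have lower (g : V -> R) e : continuous g -> (forall p, 0 <= g p <= 1) -> 0 < e ->
    exists K, forall k, (K <= k)%N ->
      Ex P (g \o joint Z X) <= Ex P (g \o joint Z (Xk k)) + e.
  move=> cg g01 e0; have e20 : 0 < e / 2 by rewrite divr_gt0.
  pose m := Num.trunc (e / 2)^-1.
  have m0 : (0 : R) < m.+1%:R by rewrite ltr0n.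
  have me : m.+1%:R^-1 <= e / 2.
    by apply/ltW; rewrite invf_plt ?posrE//; exact: truncnS_gt.
  pose G (j : 'I_m.+1) : set V := [set p | j%:R < m.+1%:R * g p].
  have oG j : open (G j).
    apply: (@open_comp _ _ (fun p => m.+1%:R * g p) [set t | j%:R < t]); last exact: open_gt.
    by move=> x _; apply: cvgM; [exact: cvg_cst|exact: cg].
  have [K KP] := choice (fun j => openE (G j) (e / 2) (oG j) e20).
  have gn p : `|g p| <= 1 by have /andP[g0 g1] := g01 p; rewrite ger0_norm.
  have mG X' j : (forall n, random_var (X' n)) -> measurable (joint Z X' @^-1` G j).
    by move=> mX'; apply: (mpair mX').
  have cake X' w : g (joint Z X' w) <=
      m.+1%:R^-1 * \sum_j \1_(joint Z X' @^-1` G j) w <= g (joint Z X' w) + m.+1%:R^-1.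
    have := layer_cake m (g01 (joint Z X' w)).
    rewrite (eq_bigr (fun j => \1_(joint Z X' @^-1` G j) w))// => j _.
    by rewrite indicE; congr ((nat_of_bool _)%:R); apply/idP/idP; rewrite inE.
  have ExG X' : (forall n, random_var (X' n)) ->
      Ex P (fun w => m.+1%:R^-1 * \sum_j \1_(joint Z X' @^-1` G j) w) =
      m.+1%:R^-1 * \sum_j pr P (joint Z X' @^-1` G j).
    move=> mX'; rewrite ExZ; last by apply: bounded_mfun_sum => j; exact/bounded_mfun_indic/mG.
    rewrite Ex_sum; last by move=> j; exact/bounded_mfun_indic/mG.
    by congr (_ * _); apply: eq_bigr => j _; rewrite Ex_indic//; exact: mG.
  have bG X' : (forall n, random_var (X' n)) ->
      bounded_mfun (fun w => m.+1%:R^-1 * \sum_j \1_(joint Z X' @^-1` G j) w : R).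
    by move=> mX'; apply: bounded_mfunZ; apply: bounded_mfun_sum => j; exact/bounded_mfun_indic/mG.
  exists (\max_j K j)%N => k kK.
  apply: (@le_trans _ _ (m.+1%:R^-1 * \sum_j pr P (joint Z X @^-1` G j))).
    rewrite -ExG//; apply: Ex_le => [|| w]; [exact: bounded_mfun_joint gn|exact: bG|].
    by have /andP[] := cake X w.
  apply: (@le_trans _ _ (m.+1%:R^-1 * \sum_j pr P (joint Z (Xk k) @^-1` G j) + e / 2)).
    rewrite -lerBlDl -mulrBr -sumrB ler_pdivrMl//.
    apply: (@le_trans _ _ (\sum_(j < m.+1) e / 2)).
      apply: ler_sum => j _; rewrite lerBlDl; apply: KP.
      by apply: leq_trans kK; exact: leq_bigmax.
    by rewrite sumr_const card_ord mulr_natl.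
  rewrite [X in _ <= _ + X](splitr e) addrA lerD2r -ExG//.
  apply: (@le_trans _ _ (Ex P (fun w => g (joint Z (Xk k) w) + m.+1%:R^-1))).
    apply: Ex_le => [|| w]; first exact: bG.
      by apply: bounded_mfunD; [exact: (bounded_mfun_joint (mXk k) cg gn)|exact: bounded_mfun_cst].
    by have /andP[] := cake (Xk k) w.
  rewrite ExD ?Ex_cst ?lerD2l//; last exact: bounded_mfun_cst.
  exact: (bounded_mfun_joint (mXk k) cg gn).
move=> f cf [M fM].
have M0 : 0 <= M by apply: le_trans (fM (joint Z X point)).
have C0 : 0 < M + 1 by rewrite ltr_wpDl.
have D0 : 0 < 2 * (M + 1) by rewrite mulr_gt0.
have bf X' : (forall n, random_var (X' n)) -> bounded_mfun (f \o joint Z X').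
  by move=> mX'; exact: bounded_mfun_joint fM.
have ExE X' : (forall n, random_var (X' n)) ->
    (\int[P]_x (f (Z x, fun i => X' i x))%:E)%E = (Ex P (f \o joint Z X'))%:E.
  by move=> mX'; rewrite /Ex /Rintegral fineK//; apply: integrable_fin_num => //; exact/bm_int/bf.
rewrite ExE//.
rewrite (_ : (fun k => _) = fun k => (Ex P (f \o joint Z (Xk k)))%:E); last first.
  by apply/funext => k; rewrite ExE.
apply: cvg_EFin; first by apply: nearW.
apply/cvgrPdist_le => e e0.
(* An affine image of [s * f] inside [[0, 1]]; the choices [s = 1] and [s = -1] yield the two sides
   of the estimate, and [M + 1] keeps the denominator positive. *)
pose g s (p : V) : R := (M + 1 + s * f p) / (2 * (M + 1)).
have gE s X' : (forall n, random_var (X' n)) -> Ex P (g s \o joint Z X') =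
    (M + 1 + s * Ex P (f \o joint Z X')) / (2 * (M + 1)).
  move=> mX'; rewrite mulrC.
  transitivity (Ex P (fun w => (2 * (M + 1))^-1 * ((M + 1) + s * (f \o joint Z X') w))).
    by congr Ex; apply/funext => w; rewrite /g /= mulrC.
  have bs : bounded_mfun (fun w => s * (f \o joint Z X') w) by apply: bounded_mfunZ; exact: bf.
  have bD : bounded_mfun (fun w => (M + 1) + s * (f \o joint Z X') w).
    by apply: bounded_mfunD => //; exact: bounded_mfun_cst.
  rewrite ExZ// ExD//; last exact: bounded_mfun_cst.
  by rewrite Ex_cst ExZ//; exact: bf.
have cg s : continuous (g s).
  move=> p; apply: cvgM; last exact: cvg_cst.
  by apply: cvgD; [exact: cvg_cst|apply: cvgM; [exact: cvg_cst|exact: cf]].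
have g01 s p : `|s| = 1 -> 0 <= g s p <= 1.
  move=> s1; have : `|s * f p| <= M by rewrite normrM s1 mul1r.
  rewrite ler_norml => /andP[h1 h2].
  by rewrite divr_ge0 ?(ltW D0)//= ?ler_pdivrMr ?mul1r//; lra.
have e'0 : 0 < e / (2 * (M + 1)) by rewrite divr_gt0.
have [K1 H1] := lower (g 1) _ (cg 1) (fun p => g01 1 p (normr1 _)) e'0.
have [K2 H2] := lower (g (-1)) _ (cg (-1)) (fun p => g01 (-1) p (normrN1 _)) e'0.
exists (maxn K1 K2) => // k /=; rewrite geq_max => /andP[k1 k2].
have := H1 k k1; have := H2 k k2; rewrite !gE// -!mulrDl !ler_pM2r ?invr_gt0//.
rewrite ler_norml; lra.
Qed.

End Portmanteau.

Section MainDirection.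
Context (d : measure_display) (Omega : measurableType d) (R : realType).
Variable P : probability Omega R.
Context (Zs Ys Xs : topologicalType) (N : nat) (hN : (0 < N)%N).
Variables (Z : Omega -> Zs) (Y : 'I_N -> Omega -> Ys) (X : 'I_N -> Omega -> Xs).
Hypotheses (pZ : polish R Zs) (pY : polish R Ys) (pX : polish R Xs)
  (cX : homeo_convex_lcs R Xs).
Hypotheses (mZ : random_var Z) (mY : forall n, random_var (Y n))
  (mX : forall n, random_var (X n)) (nY : nonatomic_law P (Y (Ordinal hN)))
  (ZY : forall n, meas_wrt (sigma_rv Z) (Y n)).

(** Stage [k] handles the first [k] boxes of a countable base with error [1 / k.+1]. For an open
    set, finitely many base boxes inside it carry all but [e / 2] of its probability, and they are
    all handled from some stage on. *)
Lemma causal_continuous_approximation :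
  (forall n : 'I_N, cond_indep P (sigma_gen X [set i : 'I_N | (i <= n)%N]) (sigma_rv Z)
     (sigma_gen Y [set i : 'I_N | (i <= n)%N])) ->
  exists f : nat -> forall n : 'I_N, {ptws 'I_n.+1 -> Ys} -> Xs,
    (forall k n, continuous (f k n)) /\
    conv_law P Z (fun k n w => f k n (path_upto Y n w)) X.
Proof.
move=> ci.
have [u [cu uB]] := polish_base pZ; have [v [cv vB]] := polish_base pX.
pose code (t : nat) : option (nat * {ffun 'I_N -> nat}) := unpickle t.
pose W t : set Zs := if code t is Some k then [set z | 0 < u k.1 z] else set0.
pose U t (n : 'I_N) : set Xs :=
  if code t is Some k then [set x | 0 < v (k.2 n) x] else set0.
have oW t : open (W t).
  by rewrite /W; case: (code t) => [k|]; [exact: continuous_open_pos|exact: open0].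
have oU t n : open (U t n).
  by rewrite /U; case: (code t) => [k|]; [exact: continuous_open_pos|exact: open0].
have e0 k : 0 < (k.+1%:R : R)^-1 by rewrite invr_gt0 ltr0n.
have box k := box_approximation pY cX mZ mY mX nY ZY ci k oW oU (e0 k).
pose f k := sval (cid (box k)).
have fP k := svalP (cid (box k)).
have cf k n : continuous (f k n) by case: (fP k) => + _; exact.
exists f; split => //.
have mXk k n : random_var (fun w => f k n (path_upto Y n w)).
  move=> C oC; apply: (sigma_gen_measurable mY).
  exact: (continuous_path_meas pY (cf k n)).
apply: conv_law_of_open => // G e oG eps0.
have e20 : 0 < e / 2 by rewrite divr_gt0.
pose inbox t := [set p : Zs * {ptws 'I_N -> Xs} | W t p.1 /\ forall n, U t n (p.2 n)].
pose joint (X' : 'I_N -> Omega -> Xs) w : Zs * {ptws 'I_N -> Xs} := (Z w, fun i => X' i w).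
pose D t := if `[< inbox t `<=` G >] then joint X @^-1` inbox t else set0.
have sm := @sigma_algebra_measurable _ Omega.
have mD t : measurable (D t).
  rewrite /D; case: ifP => _ //.
  rewrite (_ : _ @^-1` _ = Z @^-1` W t `&` [set w | forall n, (X n @^-1` U t n) w]).
    apply: (salgI sm); first exact: mZ.
    by apply: (salg_bigcap sm) => n; exact: mX.
  by rewrite predeqE => w; split.
have mpair X' : (forall n, random_var (X' n)) -> measurable (joint X' @^-1` G).
  by move=> mX'; apply: (prod_ptws_meas pZ pX sm mZ mX').
have GD : joint X @^-1` G = \bigcup_t D t.
  rewrite predeqE => w; split => [Gw|[t _]]; last first.
    by rewrite /D; case: asboolP => [tG /tG|_ []].
  have [k [kw kG]] := prod_ptws_box uB vB oG Gw.
  exists (pickle k) => //.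
  have inE p : inbox (pickle k) p <->
      0 < u k.1 p.1 /\ forall i, 0 < v (k.2 i) (p.2 i).
    by rewrite /inbox /W /U /code pickleK.
  rewrite /D asboolT; last by move=> p /inE /kG.
  exact/inE.
have [n Hn] := pr_bigcup_tail P mD e20.
exists (maxn n (Num.trunc (e / 2)^-1)) => k; rewrite geq_max => /andP[nk tk].
have ke : (k.+1%:R : R)^-1 <= e / 2.
  apply/ltW; rewrite invf_plt ?posrE ?ltr0n//.
  by apply: (lt_le_trans (truncnS_gt _)); rewrite ler_nat ltnS.
(* Only boxes contained in [G] are selected, so their union stays inside [G] for the simulated
   process as well. *)
pose S : {set 'I_k} := finset (fun t : 'I_k => (t < n)%N && `[< inbox t `<=` G >]).
have mbox X' : (forall n, random_var (X' n)) -> measurable (in_boxes Z W U S X').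
  exact: in_boxes_measurable.
have mbig : measurable (\big[setU/set0]_(t < n) D t) by exact: bigsetU_measurable.
have sub1 : \big[setU/set0]_(t < n) D t `<=` in_boxes Z W U S X.
  move=> w /bigsetUP[t [_]]; rewrite /D; case: asboolP => [tG [Wt Ut]|_ []].
  exists (Ordinal (leq_trans (ltn_ord t) nk)); split => //.
  by rewrite finset.in_set /= ltn_ord /=; apply/asboolP.
have sub2 : in_boxes Z W U S (fun n w => f k n (path_upto Y n w)) `<=`
    joint (fun n w => f k n (path_upto Y n w)) @^-1` G.
  move=> w [t [+ Wt Ut]]; rewrite finset.in_set => /andP[_ /asboolP tG].
  exact: tG.
have -> : pr P (joint X @^-1` G) = pr P ((joint X @^-1` G) `&` \big[setU/set0]_(t < n) D t)
   + pr P ((\bigcup_t D t) `\` \big[setU/set0]_(t < n) D t).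
  by rewrite (pr_split P (mpair X mX) mbig) GD.
rewrite (splitr e) addrA; apply: lerD; last exact: ltW.
apply: (@le_trans _ _ (pr P (in_boxes Z W U S X))).
  apply: le_pr; [by apply: measurableI => //; exact: mpair|exact: mbox|].
  by move=> w [_]; exact: sub1.
have [_ /(_ S) H] := fP k; apply: (le_trans H); apply: lerD => //.
by apply: le_pr => //; [exact: mbox (mXk k)|exact: mpair (mXk k)].
Qed.

End MainDirection.

(** * Limits in law of adapted processes *)

(** The interchange of limits: the bound between [a] and [b] is uniform in [k]. *)
Lemma cvg_approximation (R : realType) (a : nat -> R) (l : R) :
  (forall e, 0 < e -> exists (b : nat -> R) l', [/\ b @ \oo --> l',
     forall k, `|a k - b k| <= e & `|l - l'| <= e]) ->
  a @ \oo --> l.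
Proof.
move=> H; apply/cvgrPdist_le => e e0.
have e30 : 0 < e / 3 by rewrite divr_gt0.
have [b [l' [bl ab ll']]] := H _ e30.
move/cvgrPdist_le : bl => /(_ _ e30); apply: filterS => k bk.
rewrite (_ : l - a k = (l - l') + (l' - b k) + (b k - a k)); last by ring.
apply: (le_trans (ler_normD _ _)); rewrite (_ : e = e / 3 + e / 3 + e / 3); last by field.
apply: lerD; last by rewrite distrC; exact: ab.
by apply: (le_trans (ler_normD _ _)); exact: lerD.
Qed.

Section LimitsAreCausal.
Context (d : measure_display) (Omega : measurableType d) (R : realType).
Variable P : probability Omega R.
Context (Zs Ys Xs : topologicalType) (N : nat).
Variables (Z : Omega -> Zs) (Y : 'I_N -> Omega -> Ys) (X : 'I_N -> Omega -> Xs)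
  (Xk : nat -> 'I_N -> Omega -> Xs).
Hypotheses (pZ : polish R Zs) (pX : polish R Xs).
Hypotheses (mZ : random_var Z) (mY : forall n, random_var (Y n))
  (mX : forall n, random_var (X n)) (ZY : forall n, meas_wrt (sigma_rv Z) (Y n)).
Hypothesis adapted : forall k (n : 'I_N),
  meas_wrt (sigma_gen Y [set i : 'I_N | (i <= n)%N]) (Xk k n).
Hypothesis XkX : conv_law P Z Xk X.

Let mXk k n : random_var (Xk k n).
Proof. by move=> C oC; apply: (sigma_gen_measurable mY); exact: adapted. Qed.

Section Fixed.
Variables (n : 'I_N) (u : {ptws 'I_n.+1 -> Xs} -> R).
Hypotheses (cu : continuous u) (u01 : forall y, 0 <= u y <= 1).

Let phi (X' : 'I_N -> Omega -> Xs) w := u (path_upto X' n w).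

Let phi01 X' w : 0 <= phi X' w <= 1. Proof. exact: u01. Qed.

Lemma phi_F_fun (F : set (set Omega)) X' : sigma_algebra setT F ->
  (forall i : 'I_N, (i <= n)%N -> meas_wrt F (X' i)) -> F_fun F (phi X').
Proof.
move=> sF FX'; apply/(F_funP sF).
apply: (@random_var_real _ (g_sigma_algebraType F)) => C oC.
apply: sub_sigma_algebra.
have oD : open (u @^-1` C) by apply: open_comp oC => x _; exact: cu.
apply: (@ptws_meas_wrt R Omega _ _ (fun i : 'I_n.+1 => X' (widen_ord (ltn_ord n) i))
  F pX sF _ _ oD).
by move=> i; apply: FX'; rewrite /= -ltnS.
Qed.

Lemma phi_bounded X' : (forall i, random_var (X' i)) -> bounded_mfun (phi X').
Proof.
move=> mX'; apply: bounded_mfun_01 => //.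
have Fphi : F_fun measurable (phi X').
  by apply: phi_F_fun => [|i _]; [exact: sigma_algebra_measurable|exact: mX'].
by apply: (F_fun_measurable _ Fphi).
Qed.

(** The indicator of [B] is exchanged for a continuous function [v] of [Z], so that convergence in
    law applies to the product of [u] and [v]. The exceptional event comes from [Z] alone, so the
    error is the same for every [k]. *)
Lemma phi_cvg_indic B : sigma_rv Z B ->
  Ex P (fun w => phi (Xk k) w * \1_B w) @[k --> \oo] -->
  Ex P (fun w => phi X w * \1_B w).
Proof.
move=> HB; apply: cvg_approximation => e e0.
have mB : measurable B by apply: (sigma_gen_measurable _ HB) => _; exact: mZ.
have [_ /(_ e e0)[v [cv v01 [E [mE Ee vE]]]]] :=
  lusin_sigma_gen P pZ (fun _ : unit => mZ) HB.
pose r1 (p : Zs * {ptws 'I_N -> Xs}) : {ptws 'I_n.+1 -> Xs} :=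
  fun i => p.2 (widen_ord (ltn_ord n) i).
(* [sigma_rv] is generated by a family indexed by [unit], so [v] is a function on the product over
   [unit]. *)
pose r2 (p : Zs * {ptws 'I_N -> Xs}) : {ptws unit -> Zs} := fun _ => p.1.
pose f p : R := u (r1 p) * v (r2 p).
have c1 : continuous r1.
  apply: continuous_to_ptws => i p.
  apply: (@continuous_comp _ _ _ snd (fun x : {ptws 'I_N -> Xs} => x (widen_ord (ltn_ord n) i))).
    exact: cvg_snd.
  exact: ptws_proj_continuous.
have c2 : continuous r2 by apply: continuous_to_ptws => i p; exact: cvg_fst.
have cur : continuous (u \o r1) by move=> p; apply: continuous_comp; [exact: c1|exact: cu].
have cvr : continuous (v \o r2) by move=> p; apply: continuous_comp; [exact: c2|exact: cv].
have cf : continuous f by move=> p; exact: cvgM (cur p) (cvr p).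
have f1 p : `|f p| <= 1.
  have /andP[a0 a1] := u01 (r1 p); have /andP[b0 b1] := v01 (r2 p).
  by rewrite normrM !ger0_norm// mulr_ile1.
have vm : bounded_mfun (fun w => v (fun _ => Z w)).
  apply: bounded_mfun_01 => //; apply: random_var_real => C oC.
  have oD : open (v @^-1` C) by apply: open_comp oC => x _; exact: cv.
  exact: (@ptws_meas_wrt R Omega _ _ (fun _ : unit => Z) measurable pZ
    (@sigma_algebra_measurable _ _) (fun=> mZ) _ oD).
exists (fun k => Ex P (fun w => phi (Xk k) w * v (fun _ => Z w))),
  (Ex P (fun w => phi X w * v (fun _ => Z w))).
have close X' : (forall i, random_var (X' i)) ->
    `|Ex P (fun w => phi X' w * \1_B w) - Ex P (fun w => phi X' w * v (fun _ => Z w))| <= e.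
  move=> mX'; apply: (le_trans _ (ltW Ee)); apply: Ex_dist_off => //.
  - by apply: bounded_mfunM; [exact: phi_bounded|exact: bounded_mfun_indic].
  - by apply: bounded_mfunM => //; exact: phi_bounded.
  - move=> w; have /andP[a0 a1] := phi01 X' w; have /andP[b0 b1] := v01 (fun _ => Z w).
    rewrite -mulrBr normrM (ger0_norm a0); apply: mulr_ile1 => //.
    rewrite ler_norml indicE.
    by case: (w \in B) => /=; lra.
  - by move=> w /vE ->.
split; [|by move=> k; exact: close|exact: close].
have := XkX cf (ex_intro _ 1 f1).
have bf : bounded_mfun (fun w => f (Z w, fun i => X i w)).
  by apply: bounded_mfunM => //; exact: phi_bounded.
have fin : (\int[P]_x (f (Z x, fun i => X i x))%:E)%E \is a fin_num.
  by apply: integrable_fin_num => //; exact: bm_int.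
by rewrite -(fineK fin) => /fine_cvg.
Qed.

(** The layer-cake average of [h] combines finitely many events of [sigma_rv Z], each covered by
    [phi_cvg_indic], and is uniformly close to [h]. *)
Lemma phi_cvg h : F_fun (sigma_rv Z) h -> (forall w, 0 <= h w <= 1) ->
  Ex P (fun w => phi (Xk k) w * h w) @[k --> \oo] --> Ex P (fun w => phi X w * h w).
Proof.
move=> Fh h01; apply: cvg_approximation => e e0.
have Hm : sigma_rv Z `<=` measurable by apply: sigma_gen_measurable => _; exact: mZ.
have bh : bounded_mfun h by apply: bounded_mfun_01 => //; exact: F_fun_measurable Fh.
pose m := Num.trunc e^-1.
have me : (m.+1%:R : R)^-1 <= e.
  by apply/ltW; rewrite invf_plt ?posrE ?ltr0n//; exact: truncnS_gt.
pose C (j : 'I_m.+1) := [set x | j%:R < m.+1%:R * h x].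
have HC j : sigma_rv Z (C j).
  rewrite (_ : C j = h @^-1` `]j%:R / m.+1%:R, +oo[%classic).
    by apply: Fh; exact: measurable_itv.
  rewrite predeqE => x; rewrite /C /= in_itv/= andbT.
  by rewrite ltr_pdivrMr ?ltr0n// mulrC.
have mC j := Hm _ (HC j).
pose hm (x : Omega) : R := m.+1%:R^-1 * \sum_j \1_(C j) x.
have hmE x : h x <= hm x <= h x + m.+1%:R^-1.
  have := layer_cake m (h01 x); rewrite /hm.
  rewrite (eq_bigr (fun j : 'I_m.+1 => \1_(C j) x)) // => j _.
  by rewrite indicE; congr ((nat_of_bool _)%:R); apply/idP/idP; rewrite inE.
have bC j : bounded_mfun (\1_(C j) : _ -> R) by exact: bounded_mfun_indic.
have bhm : bounded_mfun hm by apply: bounded_mfunZ; exact: bounded_mfun_sum.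
have Ehm X' : (forall i, random_var (X' i)) -> Ex P (fun x => phi X' x * hm x) =
    m.+1%:R^-1 * \sum_j Ex P (fun x => phi X' x * \1_(C j) x).
  move=> mX'; have bp := phi_bounded mX'.
  rewrite -Ex_sum; last by move=> j; exact: bounded_mfunM.
  rewrite -ExZ; last by apply: bounded_mfun_sum => j; exact: bounded_mfunM.
  by congr Ex; apply/funext => x; rewrite /hm mulrCA mulr_sumr.
exists (fun k => Ex P (fun w => phi (Xk k) w * hm w)), (Ex P (fun w => phi X w * hm w)).
have close X' : (forall i, random_var (X' i)) ->
    `|Ex P (fun w => phi X' w * h w) - Ex P (fun w => phi X' w * hm w)| <= e.
  move=> mX'; apply: Ex_dist; [by apply: bounded_mfunM => //; exact: phi_bounded|
    by apply: bounded_mfunM => //; exact: phi_bounded|move=> w].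
  have /andP[a0 a1] := phi01 X' w; have /andP[b0 b1] := hmE w.
  rewrite -mulrBr normrM ger0_norm// -[leRHS]mul1r ler_pM//.
  by rewrite distrC ger0_norm ?subr_ge0// lerBlDl (le_trans b1)// lerD2l.
split; [|by move=> k; exact: close|exact: close].
rewrite Ehm// (_ : (fun k => _) = fun k =>
    m.+1%:R^-1 * \sum_j Ex P (fun x => phi (Xk k) x * \1_(C j) x)); last first.
  by apply/funext => k; rewrite Ehm.
apply: cvgM; first exact: cvg_cst.
elim: (index_enum _) => [|j r IH].
  by under eq_fun do rewrite big_nil; rewrite big_nil; exact: cvg_cst.
under eq_fun do rewrite big_cons; rewrite big_cons.
by apply: cvgD => //; exact: phi_cvg_indic.
Qed.

End Fixed.

Lemma conv_law_cond_indep (n : 'I_N) :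
  cond_indep P (sigma_gen X [set i : 'I_N | (i <= n)%N]) (sigma_rv Z)
     (sigma_gen Y [set i : 'I_N | (i <= n)%N]).
Proof.
set G := sigma_gen X _; set F := sigma_gen Y _.
have sF : sigma_algebra setT F by exact: sigma_gen_alg.
have Fm : F `<=` measurable by exact: sigma_gen_measurable.
have Gm : G `<=` measurable by exact: sigma_gen_measurable.
have Hm : sigma_rv Z `<=` measurable by apply: sigma_gen_measurable => _; exact: mZ.
have sH : sigma_algebra setT (sigma_rv Z) by exact: sigma_gen_alg.
have FH : F `<=` sigma_rv Z by apply: sigma_gen_min => // i _; exact: ZY.
apply: causal_cond_indep => // A B g GA HB gv.
have mA := Gm A GA; have mB := Hm B HB.
have [Fg g01 gE] := gv; have bg := version_bounded Fm gv.
apply/eqP; rewrite -subr_eq0 -normr_eq0 eq_le normr_ge0 andbT.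
apply/ler_addgt0Pr => e e0; rewrite add0r.
have e20 : 0 < e / 2 by rewrite divr_gt0.
have [_ /(_ _ e20)[u [cu u01 [E [mE Ee uE]]]]] :=
  lusin_sigma_gen P pX (fun i => mX _) (sigma_gen_upto GA).
pose phi (X' : 'I_N -> Omega -> Xs) w := u (path_upto X' n w).
have bphi : bounded_mfun (phi X) by exact: phi_bounded.
have lim1 : Ex P (fun w => phi (Xk k) w * \1_B w) @[k --> \oo] -->
    Ex P (fun w => phi X w * \1_B w) by exact: phi_cvg_indic.
have lim2 : Ex P (fun w => phi (Xk k) w * g w) @[k --> \oo] -->
    Ex P (fun w => phi X w * g w).
  by apply: phi_cvg => // C mC; apply: FH; exact: Fg.
(* Adaptedness enters here: [phi (Xk k)] is [F]-measurable, so the indicator of [B] may be replaced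
   by its conditional probability [g]. *)
have eqk k : Ex P (fun w => phi (Xk k) w * \1_B w) = Ex P (fun w => phi (Xk k) w * g w).
  apply: (pull_out Fm (bounded_mfun_indic R mB) bg) => [C FC||w].
  - rewrite gE// -Ex_indic; last by apply: measurableI => //; exact: Fm.
    by congr Ex; apply/funext => w; rewrite indicI.
  - apply: phi_F_fun => // i iln C oC.
    have := @adapted k i C oC; apply: sigma_gen_min => // j /= ji D oD.
    by apply: sigma_gen_open => //=; exact: leq_trans iln.
  - exact: u01.
have eqlim : Ex P (fun w => phi X w * \1_B w) = Ex P (fun w => phi X w * g w).
  move: lim1; under eq_fun do rewrite eqk; move=> lim1.
  exact: cvg_unique lim1 lim2.
have d1 : `|pr P (A `&` B) - Ex P (fun w => phi X w * \1_B w)| <= e / 2.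
  rewrite -Ex_indic; last exact: measurableI.
  apply: (le_trans _ (ltW Ee)); apply: Ex_dist_off => //.
  - exact/bounded_mfun_indic/measurableI.
  - by apply: bounded_mfunM => //; exact: bounded_mfun_indic.
  - move=> w; have /andP[a0 a1] : 0 <= phi X w <= 1 := u01 _.
    rewrite indicI /= !indicE ler_norml.
    by case: (w \in A); case: (w \in B) => /=; lra.
  - by move=> w /uE uw; rewrite indicI /= -uw.
have d2 : `|Ex P (fun w => g w * \1_A w) - Ex P (fun w => phi X w * g w)| <= e / 2.
  apply: (le_trans _ (ltW Ee)); apply: Ex_dist_off => //.
  - by apply: bounded_mfunM => //; exact: bounded_mfun_indic.
  - exact: bounded_mfunM.
  - move=> w; have /andP[a0 a1] : 0 <= phi X w <= 1 := u01 _.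
    have /andP[b0 b1] := g01 w.
    rewrite [phi X w * _]mulrC -mulrBr normrM (ger0_norm b0); apply: mulr_ile1 => //.
    by rewrite ler_norml indicE; case: (w \in A) => /=; lra.
  - by move=> w /uE uw; rewrite mulrC -uw.
rewrite (_ : pr P (A `&` B) - _ = (pr P (A `&` B) - Ex P (fun w => phi X w * \1_B w))
   - (Ex P (fun w => g w * \1_A w) - Ex P (fun w => phi X w * g w))); last first.
  by rewrite eqlim; ring.
by apply: (le_trans (ler_normB _ _)); rewrite (splitr e) lerD.
Qed.

End LimitsAreCausal.

Theorem theorem3p1 (R : realType) (d : measure_display) (Omega : measurableType d)
  (P : probability Omega R) (Zs Ys Xs : topologicalType) (N : nat) (hN : (0 < N)%N)
  (Z : Omega -> Zs) (Y : 'I_N -> Omega -> Ys) (X : 'I_N -> Omega -> Xs) :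
  polish R Zs -> polish R Ys -> polish R Xs -> homeo_convex_lcs R Xs ->
  random_var Z -> (forall n, random_var (Y n)) -> (forall n, random_var (X n)) ->
  nonatomic_law P (Y (Ordinal hN)) ->
  (forall n, meas_wrt (sigma_rv Z) (Y n)) ->
  [<->
    (* (i) *)
    (forall n : 'I_N,
       cond_indep P (sigma_gen X [set i : 'I_N | (i <= n)%N]) (sigma_rv Z)
                    (sigma_gen Y [set i : 'I_N | (i <= n)%N]));
    (* (ii) *)
    (exists Xk : nat -> 'I_N -> Omega -> Xs,
       (forall k (n : 'I_N), meas_wrt (sigma_gen Y [set i : 'I_N | (i <= n)%N]) (Xk k n))
       /\ conv_law P Z Xk X);
    (* (iii) *)
    (exists Xk : nat -> 'I_N -> Omega -> Xs,
       [/\ (forall k (n : 'I_N), meas_wrt (sigma_gen Y [set i : 'I_N | (i <= n)%N]) (Xk k n)),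
           conv_law P Z Xk X &
           exists f : nat -> forall n : 'I_N, {ptws 'I_n.+1 -> Ys} -> Xs,
             (forall k n, continuous (f k n)) /\
             (forall k (n : 'I_N) w, Xk k n w = f k n (fun i => Y (widen_ord (ltn_ord n) i) w))])].
Proof.
move=> pZ pY pX cX mZ mY mX nY ZY.
have i_iii : (forall n : 'I_N,
       cond_indep P (sigma_gen X [set i : 'I_N | (i <= n)%N]) (sigma_rv Z)
                    (sigma_gen Y [set i : 'I_N | (i <= n)%N])) ->
  exists f : nat -> forall n : 'I_N, {ptws 'I_n.+1 -> Ys} -> Xs,
    [/\ forall k n, continuous (f k n),
      forall k (n : 'I_N), meas_wrt (sigma_gen Y [set i : 'I_N | (i <= n)%N])
        ((fun w => f k n (path_upto Y n w)) : Omega -> Xs) &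
      conv_law P Z (fun k n w => f k n (path_upto Y n w)) X].
  move=> ci.
  have [f [cf fX]] := causal_continuous_approximation pZ pY pX cX mZ mY mX nY ZY ci.
  by exists f; split => // k n; exact: (continuous_path_meas pY (cf k n)).
have ii_i (Xk : nat -> 'I_N -> Omega -> Xs) :
    (forall k (n : 'I_N), meas_wrt (sigma_gen Y [set i : 'I_N | (i <= n)%N]) (Xk k n)) ->
    conv_law P Z Xk X -> forall n : 'I_N,
      cond_indep P (sigma_gen X [set i : 'I_N | (i <= n)%N]) (sigma_rv Z)
                   (sigma_gen Y [set i : 'I_N | (i <= n)%N]).
  by move=> aX XkX n; exact: (conv_law_cond_indep pZ pX mZ mY mX ZY aX XkX).
tfae.
- by move=> /i_iii[f [cf aX fX]]; exists (fun k (n : 'I_N) w => f k n (path_upto Y n w)).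
(* The given sequence is not made continuous; it only serves to establish (i), from which a new
   sequence is built. *)
- move=> [Xk [aX XkX]]; have [f [cf aX' fX]] := i_iii (ii_i Xk aX XkX).
  by exists (fun k (n : 'I_N) w => f k n (path_upto Y n w)); split => //; exists f.
- by move=> [Xk [aX XkX _]]; exact: ii_i XkX.
Qed.
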